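(* For every positive formula $\psi(\vec{G},\vec{A})$ in the language of groups, with $\vec{G}=(G_1,\ldots,G_m)$, and every tuple $\vec{a}\in(\mathrm{Aut}(\overline{\mathbb{Q}}))^l$ of parameters, the set $$S_{\psi,\vec{a}}=\{\vec{g}\in(\mathrm{Aut}(\overline{\mathbb{Q}}))^m:\mathrm{Aut}(\overline{\mathbb{Q}})\models\psi(\vec{g},\vec{a})\}$$ is a $\Pi^0_1$ set of reals relative to $\vec{a}$ (i.e. relative to $a_1\oplus\cdots\oplus a_l$), and the $\Pi^0_1$ property defining it is uniform in both $\psi$ and $\vec{a}$.
   Context: $\overline{\mathbb{Q}}$ is a fixed computable presentation (domain $\omega$) of the algebraic closure of $\mathbb{Q}$. Let $F_0=\mathbb{Q}\subset F_1\subset\cdots$ be the computable sequence of number fields, each normal over $\mathbb{Q}$, with $\bigcup_nF_n=\overline{\mathbb{Q}}$, where $F_n=\mathbb{Q}(z_n)$ for effectively found primitive generators $z_n$ ($F_{n+1}$ is generated by $F_n$ and all $\mathbb{Q}$-conjugates of the least element of $\overline{\mathbb{Q}}\setminus F_n$). Each $f\in\mathrm{Aut}(\overline{\mathbb{Q}})$ is identified with the real $(f(z_1),f(z_2),\ldots)\in\omega^\omega$; tuples of automorphisms are identified with joins of these reals. A formula in prenex form is positive if it does not use $\neg$. *)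

(* Defs.v *)
From HB Require Import structures.
From mathcomp Require Import all_boot all_algebra all_field.
From mathcomp Require Import boolp classical_sets.

Set Implicit Arguments.
Unset Strict Implicit.
Unset Printing Implicit Defensive.

Import GRing.Theory.

Local Open Scope classical_set_scope.

(* Kleene's partial recursive functionals: [prog n] is the syntax of n-ary
   partial recursive functions with access to one total oracle. *)
Inductive prog : nat -> Type :=
| Zero n : prog n
| Succ : prog 1
| Proj n (i : 'I_n) : prog n
| Oracle : prog 1
| Comp k n (f : prog k) (g : 'I_k -> prog n) : prog n
| Prec n (f : prog n) (g : prog n.+2) : prog n.+1
| Mu n (f : prog n.+1) : prog n.

(* [prec_graph f g xs x v]: h(x) = v, where h(0) = f(xs) and
   h(y+1) = g(y, h(y), xs). *)
Fixpoint prec_graph n (f : n.-tuple nat -> nat -> Prop)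
    (g : n.+2.-tuple nat -> nat -> Prop) (xs : n.-tuple nat) (x v : nat) : Prop :=
  match x with
  | 0 => f xs v
  | y.+1 => exists2 w, prec_graph f g xs y w & g [tuple of y :: w :: xs] v
  end.

(* [eval O p xs v]: with oracle [O], the program [p] halts on input [xs] with
   output [v]. *)
Fixpoint eval (O : nat -> nat) n (p : prog n) : n.-tuple nat -> nat -> Prop :=
  match p in prog n return n.-tuple nat -> nat -> Prop with
  | Zero _ => fun _ v => v = 0
  | Succ => fun xs v => v = (thead xs).+1
  | Proj _ i => fun xs v => v = tnth xs i
  | Oracle => fun xs v => v = O (thead xs)
  | Comp k _ f g => fun xs v =>
      exists2 ys : k.-tuple nat,
        (forall i, eval O (g i) xs (tnth ys i)) & eval O f ys v
  | Prec _ f g => fun xs v =>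
      prec_graph (eval O f) (eval O g) [tuple of behead xs] (thead xs) v
  | Mu _ f => fun xs v =>
      eval O f [tuple of v :: xs] 0 /\
      (forall i, i < v -> exists w, eval O f [tuple of i :: xs] w.+1)
  end.

(* Absolute (oracle-free) computability: the output does not depend on [O]. *)
Definition computable1 (f : nat -> nat) : Prop :=
  exists p : prog 1, forall O x, eval O p [tuple x] (f x).
Definition computable2 (f : nat -> nat -> nat) : Prop :=
  exists p : prog 2, forall O x y, eval O p [tuple x; y] (f x y).

(* A real is an element of [nat -> nat]. *)
Definition join (A X : nat -> nat) : nat -> nat :=
  fun j => if odd j then X j./2 else A j./2.

(* The join of X_0, ..., X_(m-1) sends m * q + i (i < m) to X_i(q); the empty
   join is constantly 0. *)
Definition joins m (X : m.-tuple (nat -> nat)) : nat -> nat :=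
  fun j => nth (fun=> 0) X (j %% m) (j %/ m).

(* [Pi01_by p c A S]: S = {X | forall k, R(k, c, A (+) X)}, where R is the
   relation decided by [p] (1 for true, 0 for false) when its last arguments are
   set to [c]; [p] has to halt for this oracle A and every real X. *)
Definition Pi01_by n (p : prog n.+1) (c : n.-tuple nat)
    (A : nat -> nat) (S : set (nat -> nat)) : Prop :=
  (forall X k, exists b : bool, eval (join A X) p [tuple of k :: c] b) /\
  S = [set X | forall k, eval (join A X) p [tuple of k :: c] 1].

Definition Pi01_rel (A : nat -> nat) (S : set (nat -> nat)) : Prop :=
  exists p : prog 1, Pi01_by p [tuple] A S.

(* Variables are de Bruijn indices: in [form n] the free variables are among
   0, ..., n-1, and a quantifier binds index 0 of its body. *)
Inductive gterm (n : nat) : Type :=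
| TVar (i : 'I_n)
| TOne
| TMul (s t : gterm n)
| TInv (t : gterm n).

Inductive form : nat -> Type :=
| FEq n (s t : gterm n) : form n
| FNot n (f : form n) : form n
| FAnd n (f g : form n) : form n
| FOr n (f g : form n) : form n
| FEx n (f : form n.+1) : form n
| FAll n (f : form n.+1) : form n.

Fixpoint quantifier_free n (f : form n) : bool :=
  match f with
  | FEq _ _ _ => true
  | FNot _ f => quantifier_free f
  | FAnd _ f g | FOr _ f g => quantifier_free f && quantifier_free g
  | FEx _ _ | FAll _ _ => false
  end.

Fixpoint prenex n (f : form n) : bool :=
  match f with
  | FEx _ f | FAll _ f => prenex f
  | f => quantifier_free f
  end.

Fixpoint negation_free n (f : form n) : bool :=
  match f with
  | FEq _ _ _ => true
  | FNot _ _ => false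
  | FAnd _ f g | FOr _ f g => negation_free f && negation_free g
  | FEx _ f | FAll _ f => negation_free f
  end.

Definition positive n (f : form n) : bool := prenex f && negation_free f.

Section Satisfaction.
Local Open Scope group_scope.

Fixpoint tval_in (G : groupType) n (xs : n.-tuple G) (t : gterm n) : G :=
  match t with
  | TVar i => tnth xs i
  | TOne => 1
  | TMul s t => tval_in xs s * tval_in xs t
  | TInv t => (tval_in xs t)^-1
  end.

Fixpoint holds (G : groupType) n (f : form n) : n.-tuple G -> Prop :=
  match f in form n return n.-tuple G -> Prop with
  | FEq _ s t => fun xs => tval_in xs s = tval_in xs t
  | FNot _ f => fun xs => ~ holds f xs
  | FAnd _ f g => fun xs => holds f xs /\ holds g xs
  | FOr _ f g => fun xs => holds f xs \/ holds g xs
  | FEx _ f => fun xs => exists x : G, holds f [tuple of x :: xs]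
  | FAll _ f => fun xs => forall x : G, holds f [tuple of x :: xs]
  end.

End Satisfaction.

(* Goedel numbering, built on Cantor's pairing function. *)
Definition cantor_pair (x y : nat) : nat := ((x + y) * (x + y).+1)./2 + y.

Fixpoint code_term n (t : gterm n) : nat :=
  match t with
  | TVar i => cantor_pair 0 i
  | TOne => cantor_pair 1 0
  | TMul s t => cantor_pair 2 (cantor_pair (code_term s) (code_term t))
  | TInv t => cantor_pair 3 (code_term t)
  end.

Fixpoint code_form n (f : form n) : nat :=
  match f with
  | FEq _ s t => cantor_pair 0 (cantor_pair (code_term s) (code_term t))
  | FNot _ f => cantor_pair 1 (code_form f)
  | FAnd _ f g => cantor_pair 2 (cantor_pair (code_form f) (code_form g))
  | FOr _ f g => cantor_pair 3 (cantor_pair (code_form f) (code_form g))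
  | FEx _ f => cantor_pair 4 (code_form f)
  | FAll _ f => cantor_pair 5 (code_form f)
  end.

Section Automorphisms.
Local Open Scope ring_scope.

Definition is_autom (f : algC -> algC) : Prop :=
  [/\ zmod_morphism f, monoid_morphism f & bijective f].

Record autQbar : Type := AutQbar {
  aut_fun :> algC -> algC;
  autP : is_autom aut_fun
}.

HB.instance Definition _ := gen_eqMixin autQbar.
HB.instance Definition _ := gen_choiceMixin autQbar.

Lemma autQbar_inj (f g : autQbar) : aut_fun f = aut_fun g -> f = g.
Proof.
case: f g => [f pf] [g pg] /= E; rewrite E in pf *.
by rewrite (Prop_irrelevance pf pg).
Qed.

Lemma aut_id_subproof : is_autom (fun x => x).
Proof. by split=> //; exists id. Qed.

Lemma aut_comp_subproof (f g : autQbar) : is_autom (fun x => f (g x)).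
Proof.
case: (autP f) (autP g) => fB [f1 fM] fbij [gB [g1 gM] gbij].
split; first by move=> x y; rewrite gB fB.
  by split=> [|x y]; rewrite ?g1 ?gM ?fM.
exact: (bij_comp fbij gbij).
Qed.

Lemma aut_inv_exists (f : autQbar) :
  exists g : autQbar, forall x, g (f x) = x.
Proof.
case: (autP f) => fB [f1 fM] [g fK gK].
have gA : is_autom g.
  split; last by exists f.
    by move=> x y; apply: (can_inj fK); rewrite fB !gK.
  split=> [|x y]; apply: (can_inj fK); first by rewrite f1 gK.
  by rewrite fM !gK.
by exists (AutQbar gA).
Qed.

Definition aut_id : autQbar := AutQbar aut_id_subproof.
Definition aut_comp (f g : autQbar) : autQbar := AutQbar (aut_comp_subproof f g).
Definition aut_inv (f : autQbar) : autQbar := projT1 (cid (aut_inv_exists f)).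

Lemma aut_compA : associative aut_comp.
Proof. by move=> f g h; apply: autQbar_inj. Qed.

Lemma aut_comp1f : left_id aut_id aut_comp.
Proof. by move=> f; apply: autQbar_inj. Qed.

Lemma aut_compf1 : right_id aut_id aut_comp.
Proof. by move=> f; apply: autQbar_inj. Qed.

Lemma aut_compVf : left_inverse aut_id aut_inv aut_comp.
Proof.
move=> f; apply: autQbar_inj; apply: funext => x /=.
by rewrite /aut_inv; case: cid => g /=.
Qed.

Lemma aut_compfV : right_inverse aut_id aut_inv aut_comp.
Proof.
move=> f; apply: autQbar_inj; apply: funext => x /=.
rewrite /aut_inv; case: cid => g /= gK.
case: (autP g) => _ _ gbij; apply: (bij_inj gbij); exact: gK.
Qed.

End Automorphisms.

HB.instance Definition _ := isGroup.Build autQbar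
  aut_compA aut_comp1f aut_compf1 aut_compVf aut_compfV.

Section Presentation.
Local Open Scope ring_scope.

(* A field with domain omega isomorphic to the algebraic closure of Q, given
   through the isomorphism [elt] onto [algC]. *)
Record presentation : Type := Presentation {
  elt : nat -> algC;
  idx : algC -> nat;
  eltK : cancel elt idx;
  idxK : cancel idx elt;
  add_computable : computable2 (fun x y => idx (elt x + elt y));
  mul_computable : computable2 (fun x y => idx (elt x * elt y))
}.

Definition gen_subfield (S : set algC) : set algC :=
  [set x | forall K : {pred algC},
     divring_closed K -> (forall y, S y -> y \in K) -> x \in K].

Definition least_outside (P : presentation) (F : set algC) (k : nat) : Prop :=
  ~ F (elt P k) /\ (forall j, (j < k)%N -> F (elt P j)).

Fixpoint tower (P : presentation) (n : nat) : set algC :=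
  match n with
  | 0%N => [set x | x \in Crat]
  | n'.+1 => gen_subfield
      (tower P n' `|`
       [set y | exists2 k, least_outside P (tower P n') k
                         & root (minCpoly (elt P k)) y])
  end.

Definition primitive_generators (P : presentation) (z : nat -> nat) : Prop :=
  forall n, tower P n = gen_subfield [set elt P (z n)].

(* The real (f(z_1), f(z_2), ...); it starts with z_1, not z_0. *)
Definition aut_real (P : presentation) (z : nat -> nat) (f : autQbar) :
    nat -> nat :=
  fun n => idx P (f (elt P (z n.+1))).

Definition aut_join (P : presentation) (z : nat -> nat) m
    (g : m.-tuple autQbar) : nat -> nat :=
  joins [tuple of map (aut_real P z) g].

(* Variables 0, ..., m-1 of [psi] are G_1, ..., G_m, variables m, ..., m+l-1
   are A_1, ..., A_l. *)
Definition solution_set (P : presentation) (z : nat -> nat) m l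
    (psi : form (m + l)) (a : l.-tuple autQbar) : set (nat -> nat) :=
  [set aut_join P z g | g in [set g : m.-tuple autQbar |
                                holds psi [tuple of g ++ a]]].

End Presentation.

(* Main.v *)
From HB Require Import structures.
From mathcomp Require Import all_boot all_order all_algebra all_field.
From mathcomp Require Import boolp classical_sets.
Require Import Defs.

(** Let zeta_n generate F_n.  For a positive formula, truth in Aut is equivalent
    to truth, for every n, of the formula in which each equation s = t is weakened
    to s(zeta_n) = t(zeta_n), that is, to truth in the finite quotient Gal(F_n/Q).
    Positivity makes these conditions decrease with n; for an existential
    quantifier the witnesses at all levels have a limit by Koenig's lemma, and
    universal quantifiers are harmless because every automorphism of F_n extends.

    Each level is decidable.  Whether w is conjugate to z is tested with the
    monic integer polynomials vanishing at D z, where D clears denominators: the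
    minimal polynomial of D z divides any such polynomial, which bounds its
    coefficients.  Composition of automorphisms sigma, tau of F_n is computed by
    writing tau(zeta_n) as a rational expression in zeta_n and evaluating it at
    sigma(zeta_n).  The truth value of a formula is found by searching for a
    finite table of values of subformulas and subterms that is locally
    consistent; consistent tables are correct and, for negation-free formulas,
    always exist. *)

Set Implicit Arguments.
Unset Strict Implicit.
Unset Printing Implicit Defensive.

Import Order.TTheory GRing.Theory Num.Theory.

(** * Recursive functionals *)

(** The program has to halt on every real, including those that code no tuple of automorphisms.
    Stage k therefore begins with a decidable coherence test and answers 0 if it fails; the reals
    that pass at all stages are exactly the joins of tuples of automorphisms. The test is finite
    because the image of zeta_(k+1) determines an automorphism of F_(k+1), so all earlier values of
    the real can be recomputed from the current one. Only on coherent data does the search for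
    tables start, and there its success is known in advance.

    Of the field operations only addition and multiplication are given as computable, and programs
    handle natural numbers only. Polynomial relations are therefore arranged as equalities between
    sums with natural coefficients, and quotients are found by search.

    A searched table also replaces recursion on codes of formulas with changing environments: the
    programs only have to check it locally. As the reals start with the image of z_1, stage k treats
    F_(k+1), and level 0 is recovered from level 1 by monotonicity. *)

Lemma prec_graph_fun n (f : n.-tuple nat -> nat -> Prop) g xs x v w :
  (forall xs v w, f xs v -> f xs w -> v = w) ->
  (forall xs v w, g xs v -> g xs w -> v = w) ->
  prec_graph f g xs x v -> prec_graph f g xs x w -> v = w.
Proof.
move=> fF gF; elim: x v w => [|x IH] v w /=; first exact: fF.
by move=> [v' /IH Hv +] [w' /Hv <-]; apply: gF.
Qed.

Lemma eval_fun O n (p : prog n) xs v w : eval O p xs v -> eval O p xs w -> v = w.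
Proof.
elim: p xs v w => {n} /= [n xs v w -> ->|xs v w -> ->|n i xs v w -> ->
  |xs v w -> ->|k n f IHf g IHg xs v w|n f IHf g IHg xs v w|n f IHf xs v w] //.
- move=> [ys gys fys] [ys' gys' fys'].
  suff eq_ys : ys = ys' by rewrite eq_ys in fys; apply: IHf fys fys'.
  by apply: eq_from_tnth => i; apply: IHg (gys i) (gys' i).
- exact: prec_graph_fun.
(* The smaller of two distinct outputs would be a zero at a place where the other one demands a
   positive value. *)
- move=> [fv ltv] [fw ltw]; case: (ltngtP v w) => // lt.
    by have [u /IHf/(_ fv)] := ltw _ lt.
  by have [u /IHf/(_ fw)] := ltv _ lt.
Qed.

(* An operator binding a variable (iteration, bounded quantifier, search) applies
   its body to the value of that variable consed onto the ambient arguments. *)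
Definition recursive n (F : (nat -> nat) -> seq nat -> nat) :=
  exists p : prog n, forall O (xs : n.-tuple nat), eval O p xs (F O xs).

Definition decidable n (F : (nat -> nat) -> seq nat -> bool) :=
  recursive n (fun O xs => nat_of_bool (F O xs)).

Lemma eq_recursive n F G : (forall O xs, size xs = n -> F O xs = G O xs) ->
  recursive n F -> recursive n G.
Proof.
by move=> eqFG [p Hp]; exists p => O xs; rewrite -eqFG ?size_tuple.
Qed.

Lemma eq_decidable n P Q : (forall O xs, size xs = n -> P O xs = Q O xs) ->
  decidable n P -> decidable n Q.
Proof. by move=> eqPQ; apply: eq_recursive => O xs /eqPQ->. Qed.

Lemma decidableW n P : decidable n P ->
  recursive n (fun O xs => nat_of_bool (P O xs)).
Proof. by []. Qed.

Lemma recursive_comp k n G (f : 'I_k -> (nat -> nat) -> seq nat -> nat) :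
  recursive k G -> (forall i, recursive n (f i)) ->
  recursive n (fun O xs => G O [seq f i O xs | i <- enum 'I_k]).
Proof.
move=> [pG HG] /fin_all_exists[pf Hf]; exists (Comp pG pf) => O xs /=.
exists [tuple f i O xs | i < k] => [i|]; first by rewrite tnth_mktuple.
exact: HG.
Qed.

Lemma recursive_comp1 n G a : recursive 1 G -> recursive n a ->
  recursive n (fun O xs => G O [:: a O xs]).
Proof.
move=> HG Ha; apply: eq_recursive (@recursive_comp 1 n G (fun=> a) HG _) => //.
by move=> O xs _; rewrite enum_ordSl enum_ord0.
Qed.

Lemma recursive_comp2 n G a b : recursive 2 G -> recursive n a -> recursive n b ->
  recursive n (fun O xs => G O [:: a O xs; b O xs]).
Proof.
move=> HG Ha Hb; apply: eq_recursive (@recursive_comp 2 n G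
  (fun i => if i == ord0 then a else b) HG _) => [O xs _|i].
  by rewrite !enum_ordSl enum_ord0.
by case: ifP.
Qed.

Lemma recursive_let n F a : recursive n.+1 F -> recursive n a ->
  recursive n (fun O xs => F O (a O xs :: xs)).
Proof.
move=> HF Ha; apply: eq_recursive (@recursive_comp n.+1 n F
  (fun i => if unlift ord0 i is Some j then fun _ xs => nth 0 xs j else a) HF _).
  move=> O xs sz; congr (F O _).
  rewrite enum_ordSl /= unlift_none -map_comp; congr (_ :: _).
  under eq_map => j do rewrite /= liftK.
  rewrite (map_comp (nth 0 xs) val) val_enum_ord -sz.
  by rewrite -[in RHS](mkseq_nth 0 xs).
move=> i; case: unliftP => [j _|//].
by exists (Proj j) => O xs /=; rewrite (tnth_nth 0).
Qed.

Lemma recursive_weak n F : recursive n F ->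
  recursive n.+1 (fun O ys => F O (behead ys)).
Proof.
move=> HF; apply: eq_recursive (@recursive_comp n n.+1 F
  (fun i _ xs => nth 0 xs i.+1) HF _) => [O [//|x xs] [sz]|i].
  congr (F O _); rewrite (map_comp (nth 0 xs) val) val_enum_ord -sz.
  by rewrite -[in RHS](mkseq_nth 0 xs).
by exists (Proj (lift ord0 i)) => O xs /=; rewrite (tnth_nth 0).
Qed.

Lemma recursive_weak2 n F : recursive n F ->
  recursive n.+2 (fun O ys => F O (behead (behead ys))).
Proof. by move=> /recursive_weak/recursive_weak. Qed.

Lemma recursive_weak3 n F : recursive n F ->
  recursive n.+3 (fun O ys => F O (behead (behead (behead ys)))).
Proof. by move=> /recursive_weak2/recursive_weak. Qed.

Lemma recursive_weak4 n F : recursive n F ->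
  recursive n.+4 (fun O ys => F O (behead (behead (behead (behead ys))))).
Proof. by move=> /recursive_weak3/recursive_weak. Qed.

(** Drops the second argument, which is the accumulator in the body of an iteration and the position
    in the body of a quantifier over a listing. *)
Lemma recursive_weak_second n F : recursive n.+1 F ->
  recursive n.+2 (fun O ys => F O (head 0 ys :: behead (behead ys))).
Proof.
move=> HF; apply: eq_recursive (@recursive_comp n.+1 n.+2 F
  (fun i _ xs => nth 0 xs (bump 1 i)) HF _) => [O [//|x [//|y xs]] [sz]|i].
  congr (F O _); rewrite (map_comp (fun j => nth 0 [:: x, y & xs] (bump 1 j)) val).
  rewrite val_enum_ord -sz /=; congr (_ :: _); rewrite -[RHS](mkseq_nth 0 xs).
  by rewrite -[1%N]addn0 iotaDl -map_comp.
by exists (Proj (lift (lift ord0 ord0) i)) => O xs /=; rewrite (tnth_nth 0).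
Qed.

Lemma recursive_head n : recursive n.+1 (fun _ ys => head 0 ys).
Proof. by exists (Proj ord0) => O xs /=; rewrite (tnth_nth 0) nth0. Qed.

Lemma recursive_head1 n : recursive n.+2 (fun _ ys => head 0 (behead ys)).
Proof. exact: recursive_weak (recursive_head n). Qed.

Lemma recursive_head2 n :
  recursive n.+3 (fun _ ys => head 0 (behead (behead ys))).
Proof. exact: recursive_weak (recursive_head1 n). Qed.

Lemma recursive_head3 n :
  recursive n.+4 (fun _ ys => head 0 (behead (behead (behead ys)))).
Proof. exact: recursive_weak (recursive_head2 n). Qed.

Lemma recursive_head4 n :
  recursive n.+4.+1 (fun _ ys => head 0 (behead (behead (behead (behead ys))))).
Proof. exact: recursive_weak (recursive_head3 n). Qed.

Lemma recursive_head5 n :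
  recursive n.+4.+2 (fun _ ys =>
    head 0 (behead (behead (behead (behead (behead ys)))))).
Proof. exact: recursive_weak (recursive_head4 n). Qed.

Lemma recursive_oracle n a : recursive n a ->
  recursive n (fun O xs => O (a O xs)).
Proof.
apply: (recursive_comp1 (G := fun O ys => O (head 0 ys))).
by exists Oracle => O xs /=; rewrite /thead (tnth_nth 0) nth0.
Qed.

Lemma recursive_S n a : recursive n a -> recursive n (fun O xs => (a O xs).+1).
Proof.
apply: (recursive_comp1 (G := fun O ys => (head 0 ys).+1)).
by exists Succ => O xs /=; rewrite /thead (tnth_nth 0) nth0.
Qed.

Lemma recursive_const n c : recursive n (fun _ _ => c).
Proof.
elim: c => [|c IH]; first by exists (Zero n).
exact: recursive_S IH.
Qed.

(** [Prec] recurses on its first argument, so the number of rounds is first made an argument with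
    [recursive_let]. *)
Lemma recursive_iteri n x s b : recursive n x -> recursive n b ->
  recursive n.+2 (fun O ys =>
     s O (behead (behead ys)) (head 0 ys) (head 0 (behead ys))) ->
  recursive n (fun O xs => iteri (x O xs) (s O xs) (b O xs)).
Proof.
move=> Hx [pb Hb] [ps Hs].
apply: (recursive_let (F := fun O ys =>
  iteri (head 0 ys) (s O (behead ys)) (b O (behead ys)))) Hx.
exists (Prec pb ps) => O xs /=; rewrite /thead (tnth_nth 0) nth0.
elim: (head 0 xs) => [|y IH] /=; first exact: Hb.
by exists (iteri y (s O (behead xs)) (b O (behead xs))) => //; apply: Hs.
Qed.

Definition search (f : pred nat) : nat :=
  if pselect (exists i, f i) is left ex_f then ex_minn ex_f else 0.

Lemma searchP (f : pred nat) : (exists i, f i) -> f (search f).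
Proof. by rewrite /search; case: pselect => // ex_f _; case: ex_minnP. Qed.

Lemma search_min (f : pred nat) i : f i -> search f <= i.
Proof.
by rewrite /search; case: pselect => // ex_f fi; case: ex_minnP => j _; apply.
Qed.

Ltac rec_leaf :=
  first [ assumption
        | simple apply recursive_const
        | simple apply recursive_head | simple apply recursive_head1
        | simple apply recursive_head2 | simple apply recursive_head3
        | simple apply recursive_head4 | simple apply recursive_head5
        | simple apply recursive_weak; assumption
        | simple apply recursive_weak2; assumption
        | simple apply recursive_weak3; assumption
        | simple apply recursive_weak4; assumption ].

Lemma recursive_pred n a : recursive n a -> recursive n (fun O xs => (a O xs).-1).
Proof.
move=> Ha.
apply: (eq_recursive (F := fun O xs => iteri (a O xs) (fun i _ => i) 0)).
  by move=> O xs _; case: (a O xs).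
by apply: recursive_iteri => //; rec_leaf.
Qed.

Lemma recursive_add n a b : recursive n a -> recursive n b ->
  recursive n (fun O xs => a O xs + b O xs).
Proof.
move=> Ha Hb.
apply: (eq_recursive (F := fun O xs => iteri (b O xs) (fun _ r => r.+1) (a O xs))).
  by move=> O xs _; elim: (b O xs) => [|y IH] /=; rewrite ?addn0 ?addnS ?IH.
by apply: recursive_iteri => //; apply: recursive_S; rec_leaf.
Qed.

Lemma recursive_sub n a b : recursive n a -> recursive n b ->
  recursive n (fun O xs => a O xs - b O xs).
Proof.
move=> Ha Hb.
apply: (eq_recursive (F := fun O xs => iteri (b O xs) (fun _ r => r.-1) (a O xs))).
  by move=> O xs _; elim: (b O xs) => [|y IH] /=; rewrite ?subn0 ?subnS ?IH.
by apply: recursive_iteri => //; apply: recursive_pred; rec_leaf.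
Qed.

Lemma recursive_mul n a b : recursive n a -> recursive n b ->
  recursive n (fun O xs => a O xs * b O xs).
Proof.
move=> Ha Hb; apply: (eq_recursive
  (F := fun O xs => iteri (b O xs) (fun _ r => a O xs + r) 0)).
  by move=> O xs _; elim: (b O xs) => [|y IH] /=; rewrite ?muln0 ?mulnS ?IH.
apply: recursive_iteri => //; first by rec_leaf.
by apply: recursive_add; rec_leaf.
Qed.

Lemma decidable_not n P : decidable n P -> decidable n (fun O xs => ~~ P O xs).
Proof.
move=> HP; apply: (eq_recursive (F := fun O xs => 1 - P O xs)).
  by move=> O xs _; case: (P O xs).
by apply: recursive_sub; rec_leaf.
Qed.

Lemma decidable_and n P Q : decidable n P -> decidable n Q ->
  decidable n (fun O xs => P O xs && Q O xs).
Proof.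
move=> HP HQ; apply: (eq_recursive (F := fun O xs => P O xs * Q O xs)).
  by move=> O xs _; case: (P O xs); case: (Q O xs).
by simple apply recursive_mul.
Qed.

Lemma decidable_or n P Q : decidable n P -> decidable n Q ->
  decidable n (fun O xs => P O xs || Q O xs).
Proof.
move=> HP HQ; apply: (eq_decidable (P := fun O xs => ~~ (~~ P O xs && ~~ Q O xs))).
  by move=> O xs _; case: (P O xs); case: (Q O xs).
by apply: decidable_not; apply: decidable_and; apply: decidable_not.
Qed.

Lemma decidable_imply n P Q : decidable n P -> decidable n Q ->
  decidable n (fun O xs => P O xs ==> Q O xs).
Proof.
move=> HP HQ; apply: (eq_decidable (P := fun O xs => ~~ P O xs || Q O xs)).
  by move=> O xs _; rewrite implybE.
by apply: decidable_or => //; apply: decidable_not.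
Qed.

Lemma decidable_leq n a b : recursive n a -> recursive n b ->
  decidable n (fun O xs => a O xs <= b O xs).
Proof.
move=> Ha Hb; apply: (eq_recursive (F := fun O xs => 1 - (a O xs - b O xs))).
  by move=> O xs _; rewrite /leq; case: (a O xs - b O xs).
by apply: recursive_sub; [rec_leaf | apply: recursive_sub; rec_leaf].
Qed.

Lemma decidable_eq n a b : recursive n a -> recursive n b ->
  decidable n (fun O xs => a O xs == b O xs).
Proof.
move=> Ha Hb; apply: (eq_decidable
  (P := fun O xs => (a O xs <= b O xs) && (b O xs <= a O xs))).
  by move=> O xs _; rewrite eqn_leq.
by apply: decidable_and; apply: decidable_leq.
Qed.

Lemma decidable_all n B P : recursive n B ->
  decidable n.+1 (fun O ys => P O (behead ys) (head 0 ys)) ->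
  decidable n (fun O xs => all (P O xs) (iota 0 (B O xs))).
Proof.
move=> HB HP; apply: (eq_recursive (F := fun O xs =>
  iteri (B O xs) (fun i r => r * P O xs i) 1)) => [O xs _|].
  elim: (B O xs) => // b IH; rewrite -[in RHS]addn1 iotaD all_cat /= IH andbT.
  by case: all; case: (P O xs b).
apply: recursive_iteri => //; first by rec_leaf.
apply: recursive_mul; first by rec_leaf.
exact: recursive_weak_second HP.
Qed.

Lemma decidable_has n B P : recursive n B ->
  decidable n.+1 (fun O ys => P O (behead ys) (head 0 ys)) ->
  decidable n (fun O xs => has (P O xs) (iota 0 (B O xs))).
Proof.
move=> HB HP; apply: (eq_decidable (P := fun O xs =>
  ~~ all (fun i => ~~ P O xs i) (iota 0 (B O xs)))) => [O xs _|].
  by rewrite -has_predC; apply: eq_has => i /=; rewrite negbK.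
by apply: decidable_not; apply: decidable_all => //; apply: decidable_not.
Qed.

(** A solution is required only for the oracle and the input at hand. The final search needs this
    form: its tables need not exist when an argument is not the code of a negation-free formula. As
    [Mu] looks for a zero, the test is negated. *)
Lemma eval_search n (f : (nat -> nat) -> seq nat -> pred nat) :
  decidable n.+1 (fun O ys => f O (behead ys) (head 0 ys)) ->
  exists p : prog n, forall O (xs : n.-tuple nat),
    (exists i, f O xs i) -> eval O p xs (search (f O xs)).
Proof.
move=> /decidable_not[p Hp]; exists (Mu p) => O xs ex_f /=; split=> [|i lt_i].
  by have := Hp O [tuple of search (f O xs) :: xs]; rewrite /= searchP.
exists 0; have := Hp O [tuple of i :: xs]; rewrite /=.
by case fi: (f O xs i) => //; have := search_min fi; rewrite leqNgt lt_i.
Qed.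

Lemma recursive_search n (f : (nat -> nat) -> seq nat -> pred nat) :
  decidable n.+1 (fun O ys => f O (behead ys) (head 0 ys)) ->
  (forall O xs, exists i, f O xs i) -> recursive n (fun O xs => search (f O xs)).
Proof. by move=> /eval_search[p Hp] ex_f; exists p => O xs; apply: Hp. Qed.

Ltac rec_step :=
  first
  [ rec_leaf
  | simple apply decidable_and | simple apply decidable_or
  | simple apply decidable_not | simple apply decidable_imply
  | simple apply decidable_eq | simple apply decidable_leq
  | simple apply decidable_all | simple apply decidable_has
  | simple apply decidableW
  | simple apply recursive_S | simple apply recursive_add
  | simple apply recursive_mul | simple apply recursive_sub
  | simple apply recursive_oracle
  | simple apply recursive_iteri ].

Lemma recursive_half n a : recursive n a -> recursive n (fun O xs => (a O xs)./2).
Proof.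
move=> Ha; apply: (eq_recursive
  (F := fun O xs => search (fun h => a O xs <= (h + h).+1))) => [O xs _|].
  apply/eqP; rewrite eqn_leq; apply/andP; split.
    apply: search_min; rewrite addnn -[X in X <= _]odd_double_half -add1n.
    by rewrite leq_add2r leq_b1.
  have /half_leq : a O xs <= (search (fun h => a O xs <= (h + h).+1)).*2.+1.
    rewrite -addnn; apply: (searchP (f := fun h => a O xs <= (h + h).+1)).
    by exists (a O xs); rewrite -addSn leq_addl.
  by rewrite /= uphalf_double.
apply: recursive_search; last first.
  by move=> O xs; exists (a O xs); rewrite -addSn leq_addl.
by repeat rec_step.
Qed.

(** * Cantor pairing and codes of finite sequences *)

Lemma recursive_pair n a b : recursive n a -> recursive n b ->
  recursive n (fun O xs => cantor_pair (a O xs) (b O xs)).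
Proof.
by move=> Ha Hb; rewrite /cantor_pair; apply: recursive_add => //;
  apply: recursive_half; repeat rec_step.
Qed.

Lemma leq_cantor_pair x x' y y' : x <= x' -> y <= y' ->
  cantor_pair x y <= cantor_pair x' y'.
Proof.
move=> lex ley; apply: leq_add => //; apply: half_leq.
by apply: leq_mul; rewrite ?ltnS leq_add.
Qed.

Lemma leq_cantor_pairl x y : x <= cantor_pair x y.
Proof.
apply: leq_trans (leq_addr y _).
have /half_leq: x.*2 <= (x + y) * (x + y).+1; last by rewrite doubleK.
case: x => // x; rewrite addSn -muln2; apply: leq_mul; last by [].
by rewrite ltnS leq_addr.
Qed.

Lemma leq_cantor_pairr x y : y <= cantor_pair x y.
Proof. exact: leq_addl. Qed.

(** The pairs of sum s take their values between s(s+1)/2 and s(s+1)/2 + s, and these intervals are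
    disjoint for different s. The code thus determines the sum, and then the second component. *)
Lemma cantor_pair_inj x y x' y' :
  cantor_pair x y = cantor_pair x' y' -> x = x' /\ y = y'.
Proof.
have half_step s : (s.+1 * s.+2)./2 = (s * s.+1)./2 + s.+1.
  have -> : s.+1 * s.+2 = s * s.+1 + s.+1.*2.
    by rewrite -muln2 [s * _]mulnC -mulnDr addn2.
  by rewrite halfD odd_double andbF doubleK.
have half_lt s t : s < t -> (s * s.+1)./2 + s < (t * t.+1)./2.
  elim: t => // t IH; rewrite ltnS leq_eqVlt half_step => /predU1P[->|/IH lt].
    by rewrite addnS ltnS.
  exact: leq_trans lt (leq_addr _ _).
have sum_le u v u' v' : cantor_pair u v = cantor_pair u' v' -> u + v <= u' + v'.
  rewrite /cantor_pair => eq_p; rewrite leqNgt; apply/negP => /half_lt lt.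
  have := leq_trans lt (leq_addr v _); rewrite eq_p ltn_add2l.
  by rewrite ltnNge leq_addl.
move=> eq_p; have eq_s : x + y = x' + y'.
  by apply/eqP; rewrite eqn_leq (sum_le _ _ _ _ eq_p) (sum_le _ _ _ _ (esym eq_p)).
move: eq_p; rewrite /cantor_pair eq_s => /addnI eq_y; split=> //.
by apply: (@addIn y); rewrite eq_s eq_y.
Qed.

(** The alternative [c <= x] makes the search succeed for every [c] without surjectivity of the
    pairing, and bounds the result by [c]. It does no harm on codes of pairs, whose components are
    at most the code. *)
Definition unpair1 c := search (fun x =>
  (c <= x) || has (fun y => cantor_pair x y == c) (iota 0 c.+1)).

Definition unpair2 c := search (fun y =>
  (c <= y) || has (fun x => cantor_pair x y == c) (iota 0 c.+1)).

Lemma unpair1K x y : unpair1 (cantor_pair x y) = x.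
Proof.
rewrite /unpair1; set c := cantor_pair x y; set f := (f in search f).
have fx : f x.
  apply/orP; right; apply/hasP; exists y => //.
  by rewrite mem_iota ltnS leq_cantor_pairr.
have := search_min fx; have /orP[le|/hasP[y' _ /eqP/cantor_pair_inj[]//]] :=
  searchP (ex_intro _ x fx).
move=> le'; apply/eqP; rewrite eqn_leq le' (leq_trans _ le) //.
exact: leq_cantor_pairl.
Qed.

Lemma unpair2K x y : unpair2 (cantor_pair x y) = y.
Proof.
rewrite /unpair2; set c := cantor_pair x y; set f := (f in search f).
have fy : f y.
  apply/orP; right; apply/hasP; exists x => //.
  by rewrite mem_iota ltnS leq_cantor_pairl.
have := search_min fy; have /orP[le|/hasP[x' _ /eqP/cantor_pair_inj[]//]] :=
  searchP (ex_intro _ y fy).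
move=> le'; apply/eqP; rewrite eqn_leq le' (leq_trans _ le) //.
exact: leq_cantor_pairr.
Qed.

Lemma leq_unpair1 c : unpair1 c <= c.
Proof. by apply: search_min; rewrite leqnn. Qed.

Lemma leq_unpair2 c : unpair2 c <= c.
Proof. by apply: search_min; rewrite leqnn. Qed.

Lemma recursive_unpair1 n a : recursive n a ->
  recursive n (fun O xs => unpair1 (a O xs)).
Proof.
move=> Ha; apply: recursive_search => [|O xs].
  by repeat first [simple apply recursive_pair | rec_step].
by exists (a O xs); rewrite leqnn.
Qed.

Lemma recursive_unpair2 n a : recursive n a ->
  recursive n (fun O xs => unpair2 (a O xs)).
Proof.
move=> Ha; apply: recursive_search => [|O xs].
  by repeat first [simple apply recursive_pair | rec_step].
by exists (a O xs); rewrite leqnn.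
Qed.

Definition encode (s : seq nat) : nat := foldr cantor_pair 0 s.

Definition entry c i := unpair1 (iteri i (fun _ => unpair2) c).

Lemma entry_pair x c i :
  entry (cantor_pair x c) i = if i is j.+1 then entry c j else x.
Proof.
case: i => [|i]; rewrite /entry; first exact: unpair1K.
congr (unpair1 _); elim: i => [|i /= <-] //=.
by rewrite unpair2K.
Qed.

(** Beyond the end both sides are 0: the list ends with the code 0, which is also the code of the
    pair (0, 0). *)
Lemma entry_encode s i : entry (encode s) i = nth 0 s i.
Proof.
elim: s i => [|x s IH] i; last by rewrite entry_pair; case: i.
rewrite nth_nil; have pair0 : cantor_pair 0 0 = 0 by [].
elim: i => [|i IH]; first by rewrite /entry /= -[X in unpair1 X]pair0 unpair1K.
by rewrite -[encode _]/(cantor_pair 0 0) entry_pair.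
Qed.

Lemma leq_entry c i : entry c i <= c.
Proof.
apply: leq_trans (leq_unpair1 _) _; elim: i => //= i.
exact: leq_trans (leq_unpair2 _).
Qed.

Lemma recursive_entry n a b : recursive n a -> recursive n b ->
  recursive n (fun O xs => entry (a O xs) (b O xs)).
Proof.
move=> Ha Hb; apply: recursive_unpair1; apply: recursive_iteri => //.
by apply: recursive_unpair2; rec_leaf.
Qed.

(** The length is stored separately, because appending zeros to a list does not change its
    [encode]. *)
Definition listing c : seq nat := [seq entry (unpair2 c) i | i <- iota 0 (unpair1 c)].

Lemma listing_encode s : listing (cantor_pair (size s) (encode s)) = s.
Proof.
rewrite /listing unpair1K unpair2K (eq_map (entry_encode s)); exact: mkseq_nth.
Qed.

Lemma decidable_all_listing n a P : recursive n a ->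
  decidable n.+1 (fun O ys => P O (behead ys) (head 0 ys)) ->
  decidable n (fun O xs => all (P O xs) (listing (a O xs))).
Proof.
move=> Ha HP; apply: (eq_decidable (P := fun O xs => all (fun i =>
   P O xs (entry (unpair2 (a O xs)) i)) (iota 0 (unpair1 (a O xs))))).
  by move=> O xs _; rewrite all_map; apply: eq_all.
apply: decidable_all; first exact: recursive_unpair1.
apply: (recursive_let (F := fun O ys => P O (behead (behead ys)) (head 0 ys))).
  exact: recursive_weak_second HP.
by apply: recursive_entry; [apply: recursive_unpair2|]; rec_leaf.
Qed.

Lemma decidable_has_listing n a P : recursive n a ->
  decidable n.+1 (fun O ys => P O (behead ys) (head 0 ys)) ->
  decidable n (fun O xs => has (P O xs) (listing (a O xs))).
Proof.
move=> Ha HP; apply: (eq_decidable (P := fun O xs =>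
  ~~ all (fun i => ~~ P O xs i) (listing (a O xs)))) => [O xs _|].
  by rewrite -has_predC; apply: eq_has => i /=; rewrite negbK.
by apply: decidable_not; apply: decidable_all_listing => //; apply: decidable_not.
Qed.

Ltac rec_code_step := first
  [ rec_step
  | simple apply recursive_pair | simple apply recursive_unpair1
  | simple apply recursive_unpair2 | simple apply recursive_entry
  | simple apply decidable_all_listing | simple apply decidable_has_listing ].

Ltac rec := repeat rec_code_step.

(** * Automorphisms and the tower *)

Local Open Scope ring_scope.

Fact aut_zmod (f : autQbar) : zmod_morphism f.
Proof. by case: (autP f). Qed.
HB.instance Definition _ (f : autQbar) :=
  GRing.isZmodMorphism.Build algC algC (aut_fun f) (aut_zmod f).

Fact aut_monoid (f : autQbar) : monoid_morphism f.
Proof. by case: (autP f). Qed.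
HB.instance Definition _ (f : autQbar) :=
  GRing.isMonoidMorphism.Build algC algC (aut_fun f) (aut_monoid f).

Lemma rmorphism_autom (nu : {rmorphism algC -> algC}) : is_autom nu.
Proof.
split; [exact: rmorphB | exact: (rmorphism_monoidP nu) |].
by exists (algC_invaut nu); [apply: algC_autK | apply: algC_invautK].
Qed.

Lemma root_minCpoly_aut (f : autQbar) x : root (minCpoly x) (f x).
Proof. by rewrite -(minCpoly_aut f) root_minCpoly. Qed.

(** The roots of the minimal polynomial of [x] generate a splitting field, which is normal over the
    rationals. One of its automorphisms takes [x] to [y], and this one extends to [algC]. *)
Lemma conjugate_aut x y : root (minCpoly x) y -> exists f : autQbar, f x = y.
Proof.
move=> xy; have [r Dr] := closed_field_poly_normal (minCpoly x).
rewrite (monicP (minCpoly_monic x)) scale1r in Dr.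
have [Qs [QsC [s Ds genQs]]] := num_field_exists r.
have [p [Dp _] min_p] := minCpolyP x.
have QsC_alg a : QsC a%:A = ratr a by rewrite alg_num_field fmorph_rat.
have QsC_map q : map_poly QsC (map_poly (in_alg Qs) q) = map_poly ratr q.
  by rewrite -map_poly_comp; apply: eq_map_poly => a; apply: QsC_alg.
have p_over : map_poly (in_alg Qs) p \is a polyOver 1%VS.
  by apply/polyOverP => i; rewrite coef_map; apply: rpredZ (mem1v _).
have Dp2 : map_poly (in_alg Qs) p = \prod_(a <- s) ('X - a%:P).
  apply: (map_poly_inj QsC); rewrite QsC_map -Dp Dr -Ds big_map rmorph_prod.
  by apply: eq_bigr => a _; rewrite /= map_polyXsubC.
have splitQs : splitting_field_axiom Qs.
  by exists (map_poly (in_alg Qs) p) => //; exists s; rewrite ?Dp2 ?eqpxx.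
pose QsS : splittingFieldType rat :=
  HB.pack Qs (FieldExt_isSplittingField.Build rat Qs splitQs).
have in_r a : root (minCpoly x) a -> exists2 b, b \in s & QsC b = a.
  by rewrite Dr root_prod_XsubC -Ds => /mapP[b]; exists b.
have [a sa Da] := in_r x (root_minCpoly x); have [b sb Db] := in_r y xy.
(* The minimal polynomial of [a] inside the number field is rational and vanishes at [x] in [algC],
   so [minCpoly x] divides it and its root [y] is inherited. *)
have root_ab : root (minPoly 1 a) b.
  have [q Dq] : exists q : {poly rat}, minPoly 1 a = map_poly (in_alg Qs) q.
    have aP i : (minPoly 1 a)`_i \in 1%VS by apply/polyOverP/minPolyOver.
    have{aP} a_ i := sig_eqW (vlineP _ _ (aP i)).
    exists (\poly_(i < size (minPoly 1 a)) sval (a_ i)).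
    apply/polyP=> i; rewrite coef_map coef_poly /=; case: ltnP => [_|le].
      by case: (a_ i).
    by rewrite nth_default // scale0r.
  have eqC c : root (minPoly 1 a) c = root (map_poly ratr q) (QsC c).
    by rewrite -(fmorph_root QsC) Dq QsC_map.
  rewrite eqC Db; have := root_minPoly 1 a; rewrite eqC Da min_p => /dvdpP[q' ->].
  by rewrite rmorphM rootM /= -Dp xy orbT.
have [g _ Dg] : exists2 g, g \in 'Gal({:QsS} / 1)%g & g a = b.
  by apply: normalField_root_minPoly; rewrite ?sub1v ?memvf ?normalFieldf.
have [nu Dnu] := extend_algC_subfield_aut QsC (gal_repr g : {rmorphism Qs -> Qs}).
exists (AutQbar (rmorphism_autom nu)) => /=.
by rewrite -Da -Dnu /= Dg.
Qed.

Lemma gen_subfield_sub (S : set algC) x : S x -> gen_subfield S x.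
Proof. by move=> Sx K _; apply. Qed.

Lemma gen_subfield_min (S : set algC) (K : {pred algC}) :
  divring_closed K -> (forall y, S y -> y \in K) ->
  forall x, gen_subfield S x -> x \in K.
Proof. by move=> K_closed SK x; apply. Qed.

Lemma gen_subfield_closed (S : set algC) :
  divring_closed (fun x => `[< gen_subfield S x >]).
Proof.
have in_closed (op : algC -> algC -> algC) :
    (forall (K : divringClosed algC) x y, x \in K -> y \in K -> op x y \in K) ->
  forall x y, gen_subfield S x -> gen_subfield S y -> gen_subfield S (op x y).
  move=> opK x y Sx Sy K K_closed SK.
  pose KM := GRing.isDivringClosed.Build _ K K_closed.
  pose KD : divringClosed algC := HB.pack K KM.
  by apply: (opK KD); [apply: Sx | apply: Sy].
split=> [|x y /asboolP Sx /asboolP Sy|x y /asboolP Sx /asboolP Sy];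
  apply/asboolP.
- by move=> K [].
- by apply: (in_closed (fun x y => x - y)) => // K u v; apply: rpredB.
- by apply: (in_closed (fun x y => x / y)) => // K u v; apply: rpred_div.
Qed.

Lemma aut_eq_closed (f g : autQbar) : divring_closed [pred x | f x == g x].
Proof.
split=> [|x y /eqP fx /eqP fy|x y /eqP fx /eqP fy]; apply/eqP.
- by rewrite !rmorph1.
- by rewrite !rmorphB /= fx fy.
- by rewrite !fmorph_div /= fx fy.
Qed.

Lemma aut_preim_closed (f : autQbar) (K : {pred algC}) :
  divring_closed K -> divring_closed [pred x | f x \in K].
Proof.
move=> [K1 KB Kdiv]; split=> [|x y fx fy|x y fx fy]; rewrite !inE.
- by rewrite rmorph1.
- by rewrite rmorphB; apply: KB.
- by rewrite fmorph_div; apply: Kdiv.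
Qed.

Section Tower.
Variables (P : presentation) (z : nat -> nat).
Hypothesis z_generates : primitive_generators P z.

Local Notation elt := (elt P).
Local Notation idx := (idx P).
Local Notation zeta n := (elt (z n)).

Lemma tower_zeta n : tower P n (zeta n).
Proof. by rewrite z_generates; apply: gen_subfield_sub. Qed.

Lemma tower_eq_aut (f g : autQbar) n x :
  f (zeta n) = g (zeta n) -> tower P n x -> f x = g x.
Proof.
move=> eq_fg; rewrite z_generates => /(gen_subfield_min (aut_eq_closed f g)) Fx.
by apply/eqP/Fx => _ ->; apply/eqP.
Qed.

Lemma tower_mono m n x : (m <= n)%N -> tower P m x -> tower P n x.
Proof.
elim: n => [|n IH]; first by rewrite leqn0 => /eqP->.
rewrite leq_eqVlt => /predU1P[->//|/IH IHx /IHx Fx].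
by apply: gen_subfield_sub; left.
Qed.

(** By induction all elements before the n-th lie in F_n; if the n-th does not, it is the least one
    outside and is adjoined at the next step. *)
Lemma tower_elt n j : (j < n)%N -> tower P n (elt j).
Proof.
elim: n j => // n IH j; rewrite ltnS leq_eqVlt => /predU1P[->|lt]; last first.
  by apply: (@tower_mono n) => //; apply: IH.
have [Fn|notFn] := pselect (tower P n (elt n)); first exact: (@tower_mono n).
apply: gen_subfield_sub; right; exists n => //; exact: root_minCpoly.
Qed.

Lemma tower_cover x : tower P (idx x).+1 x.
Proof. by rewrite -[X in tower _ _ X](idxK P x); apply: tower_elt. Qed.

(** Normality of F_n: the preimage of F_(n+1) under [f] is a subfield, and it contains F_n and the
    adjoined conjugates, which [f] permutes. *)
Lemma tower_aut n (f : autQbar) x : tower P n x -> tower P n (f x).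
Proof.
elim: n x => [|n IH] x; first by move=> Qx; rewrite /= aut_Crat.
move=> Fx; apply/asboolP.
have closed : divring_closed (fun x => `[< tower P n.+1 x >]).
  exact: gen_subfield_closed.
apply: (gen_subfield_min (aut_preim_closed f closed)) Fx => y [Fy|].
  by apply/asboolP/gen_subfield_sub; left; apply: IH.
case=> k out_k root_y; apply/asboolP/gen_subfield_sub; right; exists k => //.
have [p [Dp _] _] := minCpolyP (elt k).
rewrite Dp -(eq_map_poly (fmorph_rat f)) map_poly_comp fmorph_root -Dp.
exact: root_y.
Qed.

Lemma autV_fun (f : autQbar) x : (f^-1)%g (f x) = x.
Proof. by rewrite -[LHS]/((f^-1 * f)%g x) mulVg. Qed.

Lemma autVK (f : autQbar) x : f ((f^-1)%g x) = x.
Proof. by rewrite -[LHS]/((f * f^-1)%g x) mulgV. Qed.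

(* Only the restriction of [s n] to F_n matters. *)
Lemma tower_glue (s : nat -> autQbar) :
  (forall j n, (j <= n)%N -> s n (zeta j) = s j (zeta j)) ->
  exists f : autQbar, forall n x, tower P n x -> f x = s n x.
Proof.
move=> s_coh; pose f x := s (idx x).+1 x.
have fE n x : tower P n x -> f x = s n x.
  move=> Fx; have Fx' := @tower_cover x; rewrite /f.
  have [le|/ltnW le] := leqP n (idx x).+1.
    by apply: (tower_eq_aut (n := n)) => //; apply: s_coh.
  by apply/esym; apply: (tower_eq_aut (n := (idx x).+1)) => //; apply: s_coh.
have common x y : exists n, tower P n x /\ tower P n y.
  exists (maxn (idx x).+1 (idx y).+1).
  by split; [apply: tower_mono (leq_maxl _ _) _ | apply: tower_mono (leq_maxr _ _) _];
    apply: tower_cover.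
have closed n : divring_closed (fun x => `[< tower P n x >]).
  by rewrite z_generates; apply: gen_subfield_closed.
have f_aut : is_autom f.
  split.
  - move=> x y; have [n [Fx Fy]] := common x y.
    rewrite !(fE n) ?rmorphB //; apply/asboolP; case: (closed n) => _ FB _.
    by apply: FB; apply/asboolP.
  - split; first by rewrite /f rmorph1.
    move=> x y; have [n [Fx Fy]] := common x y.
    pose FM := GRing.isDivringClosed.Build _ _ (closed n).
    pose F : divringClosed algC := HB.pack (fun x => `[< tower P n x >]) FM.
    rewrite !(fE n) ?rmorphM //; apply/asboolP.
    by apply: (@rpredM _ F); apply/asboolP.
  have f_inj x y : f x = f y -> x = y.
    by have [n [Fx Fy]] := common x y; rewrite !(fE n) //; apply: fmorph_inj.
  (* By normality the preimage of [y] lies in the same level as [y], so [f] can be computed there by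
     the same automorphism. *)
  have f_surj y : f ((s (idx y).+1)^-1%g y) = y.
    by rewrite (fE (idx y).+1) ?autVK //; apply: tower_aut (@tower_cover y).
  by exists (fun y => (s (idx y).+1)^-1%g y) => // x; apply: f_inj.
by exists (AutQbar f_aut).
Qed.

(** Read contrapositively, this is the infinite pigeonhole principle, applied below to the
    conjugates of the next generator. *)
Lemma finite_eventually (r : seq algC) (Q : algC -> nat -> Prop) :
  (forall v, v \in r -> exists M, forall N, (M <= N)%N -> Q v N) ->
  exists M, forall v N, v \in r -> (M <= N)%N -> Q v N.
Proof.
elim: r => [|v r IH] Hr; first by exists 0.
have [|M HM] := IH; first by move=> u ur; apply: Hr; rewrite inE ur orbT.
have [M' HM'] := Hr v (mem_head _ _).
exists (maxn M M') => u N; rewrite inE geq_max => /predU1P[-> /andP[_]|ur /andP[le _]].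
  exact: HM'.
exact: HM.
Qed.

(* Koenig's lemma: the restrictions of automorphisms to F_n are finite in number,
   as they are determined by the image of the generator. *)
Lemma aut_cluster (h : nat -> autQbar) : exists f : autQbar,
  forall n, exists2 N, (n <= N)%N & f (zeta n) = h N (zeta n).
Proof.
(* The nodes of the tree: [f] is kept at level n if infinitely many [h N] agree with it on F_n. *)
pose C n (f : autQbar) :=
  forall M, exists2 N, (M <= N)%N & h N (zeta n) = f (zeta n).
have C0 : C 0%N 1%g.
  move=> M; exists M => //; have : zeta 0 \in Crat by have := tower_zeta 0.
  by move=> Qz; rewrite !aut_Crat.
(* Otherwise each conjugate of the next generator is eventually avoided by the [h N] that agree with
   [f] on F_n, although there are infinitely many such [N]. A value taken infinitely often is
   extended by any [h N0] that takes it. *)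
have CS n f : C n f -> exists2 g, C n.+1 g & g (zeta n) = f (zeta n).
  move=> Cf; apply: contrapT => noC.
  have [r Dr] := closed_field_poly_normal (minCpoly (zeta n.+1)).
  rewrite (monicP (minCpoly_monic _)) scale1r in Dr.
  have [|M HM] := @finite_eventually r
    (fun v N => h N (zeta n) = f (zeta n) -> h N (zeta n.+1) <> v).
    move=> v _; apply: contrapT => Hv.
    have often M : exists2 N, (M <= N)%N &
        h N (zeta n) = f (zeta n) /\ h N (zeta n.+1) = v.
      apply: contrapT => notN; apply: Hv; exists M => N leMN e1 e2.
      by apply: notN; exists N.
    have [N0 _ [e1 e2]] := often 0%N; apply: noC; exists (h N0) => // M.
    by have [N le [_ e]] := often M; exists N => //; rewrite e e2.
  have [N leMN e] := Cf M; apply: (HM (h N (zeta n.+1)) N _ leMN e) => //.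
  by have := root_minCpoly_aut (h N) (zeta n.+1); rewrite Dr root_prod_XsubC.
pose next n (f : {f | C n f}) : {g | C n.+1 g} :=
  exist _ _ (s2valP (cid2 (CS n _ (svalP f)))).
pose fix seqC n : {f | C n f} := if n is m.+1 then next m (seqC m) else exist _ _ C0.
have seqCS n : sval (seqC n.+1) (zeta n) = sval (seqC n) (zeta n).
  exact: (s2valP' (cid2 (CS n _ (svalP (seqC n))))).
have [j n le_jn|f Hf] := @tower_glue (fun n => sval (seqC n)).
  elim: n le_jn => [|n IH]; first by rewrite leqn0 => /eqP->.
  rewrite leq_eqVlt ltnS => /predU1P[->//|le_jn]; rewrite -IH //.
  apply: (tower_eq_aut (n := n)) (seqCS n) _.
  exact: tower_mono le_jn (tower_zeta j).
exists f => n; have [N le e] := svalP (seqC n) n; exists N => //.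
by rewrite (Hf n _ (tower_zeta n)) e.
Qed.

(** * Truth at a finite level of the tower *)

Fixpoint holds_at (x : algC) n (f : form n) : n.-tuple autQbar -> Prop :=
  match f in form n return n.-tuple autQbar -> Prop with
  | FEq _ s t => fun xs => tval_in xs s x = tval_in xs t x
  | FNot _ f => fun xs => ~ holds_at x f xs
  | FAnd _ f g => fun xs => holds_at x f xs /\ holds_at x g xs
  | FOr _ f g => fun xs => holds_at x f xs \/ holds_at x g xs
  | FEx _ f => fun xs => exists y, holds_at x f [tuple of y :: xs]
  | FAll _ f => fun xs => forall y, holds_at x f [tuple of y :: xs]
  end.

(** The conclusion covers all of F_N and not only its generator, because a product evaluates its
    left factor at the value of the right one, which by normality is just some element of F_N. *)
Lemma tval_in_agree N n (t : gterm n) (xs ys : n.-tuple autQbar) :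
  (forall i, tnth xs i (zeta N) = tnth ys i (zeta N)) ->
  forall x, tower P N x -> tval_in xs t x = tval_in ys t x.
Proof.
move=> eq_xy; elim: t => [i|//|s IHs t IHt|t IH] x Fx /=.
- exact: tower_eq_aut (eq_xy i) Fx.
- by rewrite IHt // IHs //; apply: tower_aut.
- set f := tval_in xs t; set g := tval_in ys t.
  by rewrite -[LHS](autV_fun g) -IH ?autVK //; apply: tower_aut.
Qed.

Lemma holds_at_agree N n (f : form n) (xs ys : n.-tuple autQbar) :
  (forall i, tnth xs i (zeta N) = tnth ys i (zeta N)) ->
  holds_at (zeta N) f xs -> holds_at (zeta N) f ys.
Proof.
elim: f xs ys => {n} /=
  [n s t|n f IH|n f IHf g IHg|n f IHf g IHg|n f IH|n f IH] xs ys eq_xy.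
- by rewrite !(tval_in_agree _ eq_xy (tower_zeta N)).
- by move=> not_f /IH f_xs; apply: not_f; apply: f_xs.
- by move=> [/IHf Hf /IHg Hg]; split; [apply: Hf | apply: Hg].
- by move=> [/IHf|/IHg] H; [left | right]; apply: H.
- move=> [y /IH Hy]; exists y; apply: Hy => i; rewrite !(tnth_nth 1%g) /=.
  by case: i => [[|i] lt_i] //=; have := eq_xy (Ordinal (lt_i : (i < n)%N));
    rewrite !(tnth_nth 1%g).
- move=> Hf y; apply: IH (Hf y) => i; rewrite !(tnth_nth 1%g) /=.
  by case: i => [[|i] lt_i] //=; have := eq_xy (Ordinal (lt_i : (i < n)%N));
    rewrite !(tnth_nth 1%g).
Qed.

Lemma holds_at_mono M N n (f : form n) (xs : n.-tuple autQbar) :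
  (M <= N)%N -> negation_free f -> holds_at (zeta N) f xs -> holds_at (zeta M) f xs.
Proof.
move=> leMN; elim: f xs => {n} /=
  [n s t|n f IH|n f IHf g IHg|n f IHf g IHg|n f IH|n f IH] xs //.
- by move=> _ eq_st; apply: tower_eq_aut eq_st (tower_mono leMN (tower_zeta M)).
- by move=> /andP[/IHf Hf /IHg Hg] [/Hf ? /Hg ?].
- by move=> /andP[/IHf Hf /IHg Hg] [/Hf|/Hg]; [left | right].
- by move=> /IH Hf [y /Hf ?]; exists y.
- by move=> /IH Hf all_f y; apply: Hf.
Qed.

Lemma holdsP n (f : form n) (xs : n.-tuple autQbar) : negation_free f ->
  holds f xs <-> forall N, holds_at (zeta N) f xs.
Proof.
elim: f xs => {n} /= [n s t|n f IH|n f IHf g IHg|n f IHf g IHg|n f IH|n f IH] xs //.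
- move=> _; split=> [->//|eq_st]; apply/autQbar_inj/funext => x.
  exact: tower_eq_aut (eq_st _) (@tower_cover x).
- move=> /andP[/IHf Hf /IHg Hg]; split=> [[/Hf ? /Hg ?]//|fg].
  by split; [apply/Hf | apply/Hg] => N; case: (fg N).
- move=> /andP[nf ng]; split=> [[/(IHf _ nf) Hf N|/(IHg _ ng) Hg N]|fg].
  + by left.
  + by right.
  (* If the first disjunct fails at level M, it fails at all higher levels; the second then holds at
     arbitrarily high levels, hence at all. *)
  have [/(IHf _ nf)|] := pselect (forall N, holds_at (zeta N) f xs); first by left.
  move=> /existsNP[M not_f]; right; apply/(IHg _ ng) => N.
  apply: (holds_at_mono (leq_maxr M N) ng).
  by case: (fg (maxn M N)) => // /(holds_at_mono (leq_maxl M N) nf).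
- move=> nf; split=> [[y /(IH _ nf) Hy] N|ex_f]; first by exists y.
  (* The cluster point [y] agrees on each F_n' with a witness for some level N above n', and
     monotonicity brings the truth for that witness down to n'. *)
  have [h Hh] := choice ex_f; have [y Hy] := aut_cluster h.
  exists y; apply/(IH _ nf) => n'; have [N le e] := Hy n'.
  apply: holds_at_agree (holds_at_mono le nf (Hh N)) => i; rewrite !(tnth_nth 1%g) /=.
  by case: i => [[|i] lt_i].
- move=> nf; split=> [all_f N y|all_f y].
    by have /(IH _ nf) := all_f y.
  by apply/(IH _ nf) => N; apply: all_f.
Qed.

End Tower.

(** * Integer polynomials *)

Lemma polyOver1_rat (L : fieldExtType rat) (p : {poly L}) : p \is a polyOver 1%VS ->
  exists q : {poly rat}, p = map_poly (in_alg L) q.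
Proof.
move=> /polyOverP p_over; have a_ i := sig_eqW (vlineP _ _ (p_over i)).
exists (\poly_(i < size p) sval (a_ i)); apply/polyP=> i.
rewrite coef_map coef_poly /=; case: ltnP => [_|le]; first by case: (a_ i).
by rewrite nth_default // scale0r.
Qed.

Definition nat_poly_eval (c : nat -> nat) d (x : algC) : algC :=
  \sum_(i < d) (c i)%:R * x ^+ i.

Definition int_pos (a : int) : nat := if a is Posz n then n else 0%N.
Definition int_neg (a : int) : nat := if a is Negz n then n.+1 else 0%N.

Lemma int_posneg (a : int) : a%:~R = (int_pos a)%:R - (int_neg a)%:R :> algC.
Proof. by case: a => n /=; rewrite ?subr0 // NegzE mulrNz sub0r. Qed.

Lemma int_pos_le (a : int) : (int_pos a)%:R <= `|a%:~R| :> algC.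
Proof. by case: a => n /=; rewrite ?normr_ge0 // normr_nat. Qed.

Lemma int_neg_le (a : int) : (int_neg a)%:R <= `|a%:~R| :> algC.
Proof. by case: a => n /=; rewrite ?normr_ge0 // NegzE mulrNz normrN normr_nat. Qed.

Lemma nat_poly_eval_int (a : nat -> int) d x :
  \sum_(i < d) (a i)%:~R * x ^+ i =
  nat_poly_eval (int_pos \o a) d x - nat_poly_eval (int_neg \o a) d x.
Proof.
rewrite /nat_poly_eval -sumrB; apply: eq_bigr => i _ /=.
by rewrite int_posneg mulrBl.
Qed.

Lemma aut_nat_poly_eval (f : autQbar) c d x :
  f (nat_poly_eval c d x) = nat_poly_eval c d (f x).
Proof.
rewrite rmorph_sum; apply: eq_bigr => i _.
by rewrite rmorphM rmorphXn /= rmorph_nat.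
Qed.

Lemma eq_nat_poly_eval c c' d x : (forall i, (i < d)%N -> c i = c' i) ->
  nat_poly_eval c d x = nat_poly_eval c' d x.
Proof. by move=> eq_c; apply: eq_bigr => i _; rewrite eq_c. Qed.

(* The polynomial x^d + b' - b: integer coefficients are given as differences of
   natural numbers, so that programs need no negative numbers. *)
Definition monic_rel (b b' : nat -> nat) d (x : algC) : Prop :=
  x ^+ d + nat_poly_eval b' d x = nat_poly_eval b d x.

Lemma monic_rel_aut (f : autQbar) b b' d x :
  monic_rel b b' d x -> monic_rel b b' d (f x).
Proof.
by rewrite /monic_rel -rmorphXn -!aut_nat_poly_eval -rmorphD => ->.
Qed.

Definition monic_poly (b b' : nat -> nat) d : {poly algC} :=
  'X^d + \poly_(i < d) ((b' i)%:R - (b i)%:R).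

Lemma monic_relP b b' d x : monic_rel b b' d x <-> root (monic_poly b b' d) x.
Proof.
have -> : root (monic_poly b b' d) x =
    (x ^+ d + nat_poly_eval b' d x == nat_poly_eval b d x).
  rewrite rootE -[RHS]subr_eq0 hornerD hornerXn horner_poly -addrA -sumrB.
  by congr (_ + _ == 0); apply: eq_bigr => i _; rewrite mulrBl.
by split=> /eqP.
Qed.

Lemma size_monic_poly b b' d : size (monic_poly b b' d) = d.+1.
Proof.
by rewrite size_polyDl size_polyXn // (leq_ltn_trans (size_poly _ _)).
Qed.

Lemma monic_monic_poly b b' d : monic_poly b b' d \is monic.
Proof.
rewrite monicE lead_coefE size_monic_poly coefD coefXn coef_poly eqxx ltnn.
by rewrite addr0.
Qed.

Lemma monic_poly_int b b' d : monic_poly b b' d \is a polyOver Num.int.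
Proof.
apply/polyOverP => i; rewrite coefD coefXn coef_poly rpredD ?rpred_nat //.
by case: ifP; rewrite ?rpred0 // rpredB // rpred_nat.
Qed.

(* Cauchy's bound. *)
Lemma monic_rel_bound b b' d w : monic_rel b b' d w ->
  `|w| <= (1 + \sum_(i < d) (b i + b' i))%:R.
Proof.
move=> rel_w; have [le1|/ltW ge1] := real_leP (normr_real w) (real1 algC).
  by apply: le_trans le1 _; rewrite ler1n.
have bound : `|w| ^+ d <= (\sum_(i < d) (b i + b' i))%:R * `|w| ^+ d.-1.
  have -> : `|w| ^+ d = `|nat_poly_eval b d w - nat_poly_eval b' d w|.
    by rewrite -rel_w addrK normrX.
  apply: le_trans (ler_normB _ _) _.
  rewrite natr_sum mulr_suml /nat_poly_eval.
  apply: le_trans (lerD (ler_norm_sum _ _ _) (ler_norm_sum _ _ _)) _.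
  rewrite -big_split /=; apply: ler_sum => i _.
  rewrite !normrM !normr_nat normrX -mulrDl natrD ler_wpM2l ?addr_ge0 ?ler0n //.
  by rewrite ler_weXn2l //; case: (d) i => [[]|d' i] //=; rewrite -ltnS.
(* In degree 0 the bound reads 1 <= 0; in positive degree a factor [|w| ^+ d.-1] is cancelled. *)
have [d0|d_gt0] := posnP d.
  by move: bound; rewrite d0 big_ord0 expr0 mul0r ler10.
have := bound; rewrite -[X in _ ^+ X <= _](prednK d_gt0) exprSr mulrC.
rewrite ler_pM2r; last by rewrite exprn_gt0 // (lt_le_trans ltr01).
by move/le_trans; apply; rewrite ler_nat leq_addl.
Qed.

(** Each factor X - w turns a coefficient into the difference of one coefficient and w times
    another, which enlarges the bound by at most 1 + M. *)
Lemma prod_XsubC_coef_bound (r : seq algC) M i : 0 <= M ->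
  (forall w, w \in r -> `|w| <= M) ->
  `|(\prod_(w <- r) ('X - w%:P))`_i| <= (1 + M) ^+ size r.
Proof.
move=> M_ge0; elim: r i => [|w r IH] i Hr.
  by rewrite big_nil coef1 expr0; case: eqP => _; rewrite ?normr1 ?normr0 ?ler01.
rewrite big_cons mulrBl coefB coefXM coefCM /= exprS mulrDl mul1r.
have {}IH j : `|(\prod_(w <- r) ('X - w%:P))`_j| <= (1 + M) ^+ size r.
  by apply: IH => u ur; apply: Hr; rewrite inE ur orbT.
apply: le_trans (ler_normB _ _) (lerD _ _).
  by case: eqP => // _; rewrite normr0 exprn_ge0 // addr_ge0.
by rewrite normrM ler_pM ?Hr ?mem_head.
Qed.

Lemma minCpoly_int_coefs x : x \in Aint ->
  exists a : nat -> int, minCpoly x =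
    'X^((size (minCpoly x)).-1) + \poly_(i < (size (minCpoly x)).-1) (a i)%:~R.
Proof.
move=> /polyOverP Zx; have sz := prednK (ltnW (size_minCpoly x)).
exists (fun i => Num.floor (minCpoly x)`_i); apply/polyP => i.
rewrite coefD coefXn coef_poly floorK //.
case: ltngtP => [_|gt|->]; rewrite ?add0r ?addr0 //.
  by rewrite nth_default // -sz.
exact: (eqP (minCpoly_monic x)).
Qed.

Lemma conjugate_monic D b b' d x y : (0 < D)%N ->
  monic_rel b b' d (D%:R * x) ->
  let B := ((2 + \sum_(i < d) (b i + b' i)) ^ d)%N in
  (forall e c c', (e <= d)%N ->
    (forall i, (c i <= if i < e then B else 0)%N) ->
    (forall i, (c' i <= if i < e then B else 0)%N) ->
    monic_rel c c' e (D%:R * x) -> monic_rel c c' e (D%:R * y)) ->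
  exists f : autQbar, f x = y.
Proof.
move=> D_gt0 rel_x B Hy; have D_neq0 : D%:R != 0 :> algC by rewrite pnatr_eq0 -lt0n.
suff root_y : root (minCpoly (D%:R * x)) (D%:R * y).
  have [f Df] := conjugate_aut root_y; exists f.
  by apply: (mulfI D_neq0); rewrite -Df rmorphM /= rmorph_nat.
move: (D%:R * x) (D%:R * y) rel_x Hy => {D_gt0 D_neq0}x {}y rel_x Hy.
have Zx : x \in Aint.
  apply: root_monic_Aint (monic_monic_poly b b' d) (monic_poly_int b b' d).
  exact/monic_relP.
have [a Da] := minCpoly_int_coefs Zx; set e := _.-1 in Da.
(* The minimal polynomial is split by sign and cut off at its degree, as the shape of the tested
   coefficients demands. *)
pose c i := if (i < e)%N then int_neg (a i) else 0%N.
pose c' i := if (i < e)%N then int_pos (a i) else 0%N.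
have Dm : minCpoly x = monic_poly c c' e.
  rewrite Da /monic_poly; congr (_ + _); apply/polyP => i; rewrite !coef_poly.
  by rewrite /c /c'; case: ifP => // _; rewrite int_posneg.
have [p [Dp _] min_p] := minCpolyP x.
have dvd_m : minCpoly x %| monic_poly b b' d.
  have [q Dq] : exists q, monic_poly b b' d = map_poly ratr q.
    exists ('X^d + \poly_(i < d) ((b' i)%:R - (b i)%:R)).
    apply/polyP => i; rewrite coef_map !coefD !coefXn !coef_poly /=.
    rewrite rmorphD /= rmorph_nat; congr (_ + _).
    by case: ifP; rewrite ?rmorph0 // rmorphB /= !rmorph_nat.
  by rewrite Dq Dp dvdp_map -min_p -Dq; apply/monic_relP.
have le_ed : (e <= d)%N.
  have := dvdp_leq (monic_neq0 (monic_monic_poly b b' d)) dvd_m.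
  by rewrite size_monic_poly /e; case: size.
have [r Dr] := closed_field_poly_normal (minCpoly x).
rewrite (monicP (minCpoly_monic _)) scale1r in Dr.
have sz_r : size r = e by rewrite /e Dr size_prod_XsubC.
have coef_le i : `|(minCpoly x)`_i| <= B%:R.
  pose M : algC := (1 + \sum_(i < d) (b i + b' i))%:R.
  apply: (@le_trans _ _ ((1 + M) ^+ size r)).
    rewrite Dr; apply: prod_XsubC_coef_bound => [|w rw]; first exact: ler0n.
    apply/monic_rel_bound/monic_relP; have [q ->] := dvdpP _ _ dvd_m.
    by rewrite rootM Dr root_prod_XsubC rw orbT.
  by rewrite /B natrX /M nat1r sz_r; apply: ler_weXn2l; rewrite ?ler1n.
have a_le j : (j < e)%N -> `|(a j)%:~R| <= B%:R :> algC.
  move=> lt; have := coef_le j.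
  by rewrite Da coefD coefXn coef_poly lt ltn_eqF // add0r.
rewrite Dm; apply/monic_relP/Hy => // [i|i|]; last first.
- by apply/monic_relP; rewrite -Dm root_minCpoly.
- rewrite /c'; case: ifP => // /a_le le; rewrite -(@ler_nat algC).
  exact: le_trans (int_pos_le _) le.
- rewrite /c; case: ifP => // /a_le le; rewrite -(@ler_nat algC).
  exact: le_trans (int_neg_le _) le.
Qed.

(** An irreducible polynomial is coprime to its derivative, which has smaller degree and is nonzero
    in characteristic 0. *)
Lemma uniq_roots_minCpoly x r :
  minCpoly x = \prod_(w <- r) ('X - w%:P) -> uniq r.
Proof.
move=> Dr; have [p [Dp mon_p] min_p] := minCpolyP x.
rewrite -separable_prod_XsubC -Dr Dp separable_map unlock.
have px0 : root (map_poly ratr p) x by rewrite min_p.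
have irr_p : irreducible_poly p.
  apply/(subfx_irreducibleP px0 (monic_neq0 mon_p)) => q qx0 nz_q.
  by rewrite dvdp_leq // -min_p.
have sz_p : (1 < size p)%N by have := size_minCpoly x; rewrite Dp size_map_poly.
rewrite irreducible_poly_coprime // gtNdvdp ?lt_size_deriv ?(monic_neq0 mon_p) //.
apply/eqP => dp0; have := coef_deriv p (size p).-2.
move: (monicP mon_p); rewrite lead_coefE; case: (size p) sz_p => [|[|n]] //= _.
rewrite dp0 coef0 => lead1 /esym/eqP.
by rewrite lead1 pnatr_eq0.
Qed.

Lemma rat_poly_clear (p : {poly rat}) : exists (D : nat) (q : nat -> int),
  (0 < D)%N /\ forall i, D%:R * (map_poly ratr p)`_i = (q i)%:~R :> algC.
Proof.
have [q [a nz_a Dp]] := rat_poly_scale p.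
exists (absz a), (fun i => sgz a * q`_i); split=> [|i]; first by rewrite absz_gt0.
have -> : (absz a)%:R = (sgz a * a)%:~R :> algC.
  by rewrite -[sgz a]intz -sgrEz -normrEsg -abszE.
rewrite Dp coef_map coefZ coef_map /= !rmorphM /= fmorphV !rmorph_int.
by rewrite -mulrA mulVKf // intr_eq0.
Qed.

(** Multiplying the minimal polynomial by D^d makes it a monic polynomial in D w whose i-th
    coefficient is D^(d-i) times the old one; this is an integer if D clears all denominators. The
    list [r] consists of all the conjugates. *)
Lemma minCpoly_certificate x : exists D d b b' r,
  [/\ (0 < D)%N, size r = d, uniq r, monic_rel b b' d (D%:R * x) &
      {in r, forall w, monic_rel b b' d (D%:R * w)}].
Proof.
have [r Dr] := closed_field_poly_normal (minCpoly x).
rewrite (monicP (minCpoly_monic _)) scale1r in Dr.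
have [p [Dp mon_p] _] := minCpolyP x; have [D [q [D_gt0 Dq]]] := rat_poly_clear p.
(* One of the d - i factors D is already contained in [q i]. *)
pose d := size r; pose A i : int := D%:Z ^+ (d - i).-1 * q i.
have sz_p : size (minCpoly x) = d.+1 by rewrite Dr size_prod_XsubC.
have coef_p i : (i < d)%N ->
    (A i)%:~R = D%:R ^+ (d - i) * (minCpoly x)`_i :> algC.
  move=> lt; rewrite -[(d - i)%N in RHS]prednK ?subn_gt0 // exprSr -mulrA Dp Dq.
  by rewrite rmorphM rmorphXn.
have rel w : root (minCpoly x) w ->
    monic_rel (int_neg \o A) (int_pos \o A) d (D%:R * w).
  move=> root_w; rewrite /monic_rel.
  apply/eqP; rewrite -subr_eq0 -addrA -nat_poly_eval_int.
  have : D%:R ^+ d * (minCpoly x).[w] = 0 by rewrite (eqP root_w) mulr0.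
  rewrite horner_coef sz_p big_ord_recr /= mulrDr mulr_sumr addrC.
  have -> : (minCpoly x)`_d = 1.
    by have := monicP (minCpoly_monic x); rewrite lead_coefE sz_p.
  rewrite mul1r -exprMn => eq0; apply/eqP; rewrite -[RHS]eq0; congr (_ + _).
  apply: eq_bigr => i _; rewrite coef_p // exprMn.
  have -> : D%:R ^+ d = D%:R ^+ (d - i) * D%:R ^+ i :> algC.
    by rewrite -exprD subnK // ltnW.
  by rewrite -!mulrA; congr (_ * _); rewrite mulrCA.
exists D, d, (int_neg \o A), (int_pos \o A), r; split=> //.
- exact: uniq_roots_minCpoly Dr.
- exact/rel/root_minCpoly.
- by move=> w rw; apply: rel; rewrite Dr root_prod_XsubC.
Qed.

Definition rat_expr E c c' d (x v : algC) : Prop :=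
  E%:R * v + nat_poly_eval c' d x = nat_poly_eval c d x.

Lemma rat_expr_aut (f : autQbar) E c c' d x v :
  rat_expr E c c' d x v -> rat_expr E c c' d (f x) (f v).
Proof.
rewrite /rat_expr -!aut_nat_poly_eval => <-.
by rewrite rmorphD rmorphM /= rmorph_nat.
Qed.

Lemma rat_expr_fun E c c' d x v v' : (0 < E)%N ->
  rat_expr E c c' d x v -> rat_expr E c c' d x v' -> v = v'.
Proof.
rewrite /rat_expr => E_gt0 <- /addIr/mulfI -> //.
by rewrite pnatr_eq0 -lt0n.
Qed.

(** As [x] is algebraic, the field it generates consists of rational polynomials in [x]; [E] is a
    common denominator, and negative coefficients go to the other side. *)
Lemma gen_subfield1_expr x v : gen_subfield [set x] v ->
  exists E d c c', (0 < E)%N /\ rat_expr E c c' d x v.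
Proof.
move=> Fv; have [Qs [QsC [[|a []] // [Da] genQs]]] := num_field_exists [:: x].
have closed : divring_closed [pred y | `[< exists b, QsC b = y >]].
  split=> [|_ _ /asboolP[b <-] /asboolP[b' <-]|_ _ /asboolP[b <-] /asboolP[b' <-]];
    apply/asboolP.
  - by exists 1; rewrite rmorph1.
  - by exists (b - b'); rewrite rmorphB.
  - by exists (b / b'); rewrite fmorph_div.
have /asboolP[b <-] : v \in [pred y | `[< exists b, QsC b = y >]].
  apply: (gen_subfield_min closed) Fv => _ ->.
  by apply/asboolP; exists a.
have Kb : b \in <<1; a>>%VS by rewrite -adjoin_seq1 genQs memvf.
have [q Dq] := polyOver1_rat (Fadjoin_polyOver 1 a b).
have Db : QsC b = (map_poly ratr q).[x].
  rewrite -(Fadjoin_poly_eq Kb) Dq -Da -horner_map -map_poly_comp /=.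
  by congr _.[_]; apply: eq_map_poly => c /=; rewrite alg_num_field fmorph_rat.
have [E [A [E_gt0 DA]]] := rat_poly_clear q.
exists E, (size q), (int_pos \o A), (int_neg \o A); split=> //.
rewrite /rat_expr; apply/eqP; rewrite eq_sym -subr_eq -nat_poly_eval_int eq_sym.
apply/eqP.
rewrite Db horner_coef size_map_poly mulr_sumr; apply: eq_bigr => i _.
by rewrite mulrA DA.
Qed.

(** * Programs *)

Lemma iteri_sum d (f : nat -> nat) :
  iteri d (fun i r => (r + f i)%N) 0%N = (\sum_(i < d) f i)%N.
Proof. by elim: d => [|d IH]; rewrite ?big_ord0 // big_ord_recr /= IH. Qed.

Lemma recursive_exp n a b : recursive n a -> recursive n b ->
  recursive n (fun O xs => (a O xs ^ b O xs)%N).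
Proof.
move=> Ha Hb; apply: (eq_recursive
  (F := fun O xs => iteri (b O xs) (fun _ r => (a O xs * r)%N) 1%N)).
  by move=> O xs _; elim: (b O xs) => [|e IH] //=; rewrite IH expnS.
by rec.
Qed.

Lemma computable1_recursive f n a : computable1 f -> recursive n a ->
  recursive n (fun O xs => f (a O xs)).
Proof.
move=> [p Hp]; apply: (recursive_comp1 (G := fun _ ys => f (head 0%N ys))).
exists p => O xs; have -> : xs = [tuple head 0%N xs]; last exact: Hp.
by case/tupleP: xs => x xs; apply/val_inj; rewrite /= (tuple0 xs).
Qed.

Lemma computable2_recursive f n a b : computable2 f -> recursive n a ->
  recursive n b -> recursive n (fun O xs => f (a O xs) (b O xs)).
Proof.
move=> [p Hp]; apply: (recursive_comp2
  (G := fun _ ys => f (head 0%N ys) (head 0%N (behead ys)))).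
exists p => O xs.
have -> : xs = [tuple head 0%N xs; head 0%N (behead xs)]; last exact: Hp.
case/tupleP: xs => x xs; case/tupleP: xs => y xs.
by apply/val_inj; rewrite /= (tuple0 xs).
Qed.

(** The bound is the code of [d] copies of [B], and the pairing is monotone in both components. *)
Lemma leq_encode s d B : (size s <= d)%N -> all (fun x => x <= B)%N s ->
  (encode s <= iteri d (fun _ => cantor_pair B) 0)%N.
Proof.
elim: d s => [|d IH] [|x s] //= le_sd /andP[leB le_s].
by apply: leq_cantor_pair => //; apply: IH.
Qed.

Section Programs.
Variables (P : presentation) (z : nat -> nat).
Hypothesis z_computable : computable1 z.
Hypothesis z_generates : primitive_generators P z.

Local Notation elt := (elt P).
Local Notation idx := (idx P).
Local Notation zeta n := (elt (z n)).

(** * Arithmetic of the presented field, on indices *)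

Definition fadd x y := idx (elt x + elt y).
Definition fmul x y := idx (elt x * elt y).
Definition fnat a := idx a%:R.
Definition fexp x i := idx (elt x ^+ i).
Definition feval c d x := idx (nat_poly_eval (entry c) d (elt x)).

Lemma recursive_z n a : recursive n a -> recursive n (fun O xs => z (a O xs)).
Proof. exact: computable1_recursive. Qed.

Lemma recursive_fadd n a b : recursive n a -> recursive n b ->
  recursive n (fun O xs => fadd (a O xs) (b O xs)).
Proof. by apply: computable2_recursive; apply: add_computable. Qed.

Lemma recursive_fmul n a b : recursive n a -> recursive n b ->
  recursive n (fun O xs => fmul (a O xs) (b O xs)).
Proof. by apply: computable2_recursive; apply: mul_computable. Qed.

Lemma recursive_fnat n a : recursive n a -> recursive n (fun O xs => fnat (a O xs)).
Proof.
move=> Ha; apply: (eq_recursive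
  (F := fun O xs => iteri (a O xs) (fun _ r => fadd r (idx 1)) (idx 0))).
  move=> O xs _; elim: (a O xs) => //= m ->.
  by rewrite /fadd !idxK natr1.
by apply: recursive_iteri; rec; apply: recursive_fadd; rec.
Qed.

Lemma recursive_fexp n a b : recursive n a -> recursive n b ->
  recursive n (fun O xs => fexp (a O xs) (b O xs)).
Proof.
move=> Ha Hb; apply: (eq_recursive
  (F := fun O xs => iteri (b O xs) (fun _ r => fmul (a O xs) r) (idx 1))).
  move=> O xs _; elim: (b O xs) => //= m ->.
  by rewrite /fmul /fexp idxK exprS.
by apply: recursive_iteri; rec; apply: recursive_fmul; rec.
Qed.

Lemma recursive_feval n a b c : recursive n a -> recursive n b -> recursive n c ->
  recursive n (fun O xs => feval (a O xs) (b O xs) (c O xs)).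
Proof.
move=> Ha Hb Hc; apply: (eq_recursive (F := fun O xs => iteri (b O xs) (fun i r =>
   fadd r (fmul (fnat (entry (a O xs) i)) (fexp (c O xs) i))) (idx 0))).
  move=> O xs _; rewrite /feval /nat_poly_eval.
  elim: (b O xs) => [|m IH]; first by rewrite big_ord0.
  by rewrite big_ord_recr /= IH /fadd /fmul !idxK.
apply: recursive_iteri; rec; apply: recursive_fadd; rec; apply: recursive_fmul.
  by apply: recursive_fnat; rec.
by apply: recursive_fexp; rec.
Qed.

Ltac recf_step := first
  [ rec_code_step | simple apply recursive_exp | simple apply recursive_z
  | simple apply recursive_fadd | simple apply recursive_fmul
  | simple apply recursive_fnat | simple apply recursive_fexp
  | simple apply recursive_feval ].

Ltac recf := repeat recf_step.

Definition monic_check c c' d x :=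
  fadd (fexp x d) (feval c' d x) == feval c d x.

Lemma monic_checkP c c' d x :
  reflect (monic_rel (entry c) (entry c') d (elt x)) (monic_check c c' d x).
Proof.
rewrite /monic_check /monic_rel -(inj_eq (can_inj (@eltK P))) !idxK.
exact: eqP.
Qed.

Lemma decidable_monic_check n a b c d : recursive n a -> recursive n b ->
  recursive n c -> recursive n d -> decidable n (fun O xs =>
    monic_check (a O xs) (b O xs) (c O xs) (d O xs)).
Proof. by move=> Ha Hb Hc Hd; rewrite /monic_check; recf. Qed.

Definition expr_check E c c' d x v :=
  (0 < E)%N && (fadd (fmul (fnat E) v) (feval c' d x) == feval c d x).

Lemma expr_checkP E c c' d x v :
  reflect ((0 < E)%N /\ rat_expr E (entry c) (entry c') d (elt x) (elt v))
          (expr_check E c c' d x v).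
Proof.
rewrite /expr_check /rat_expr -(inj_eq (can_inj (@eltK P))) !idxK.
by apply: (iffP andP) => -[? /eqP].
Qed.

Lemma decidable_expr_check n a b c d e f : recursive n a -> recursive n b ->
  recursive n c -> recursive n d -> recursive n e -> recursive n f ->
  decidable n (fun O xs =>
    expr_check (a O xs) (b O xs) (c O xs) (d O xs) (e O xs) (f O xs)).
Proof. by move=> Ha Hb Hc Hd He Hf; rewrite /expr_check; recf. Qed.

(** * Deciding conjugacy over the rationals *)

(* A certificate for x codes a positive integer D, a monic integer polynomial of
   degree d vanishing at D x, and d distinct w such that it vanishes at D w. *)
Definition cert_check x q :=
  [&& (0 < entry q 0)%N,
      monic_check (entry q 2) (entry q 3) (entry q 1) (fmul (fnat (entry q 0)) x),
      all (fun i => monic_check (entry q 2) (entry q 3) (entry q 1)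
                      (fmul (fnat (entry q 0)) (entry (entry q 4) i)))
          (iota 0 (entry q 1)) &
      all (fun i => all (fun j => entry (entry q 4) i != entry (entry q 4) j)
                        (iota 0 i)) (iota 0 (entry q 1))].

Lemma elt_fmul_fnat D x : elt (fmul (fnat D) x) = D%:R * elt x.
Proof. by rewrite /fmul /fnat !idxK. Qed.

Lemma cert_check_exists x : exists q, cert_check x q.
Proof.
have [D [d [b [b' [r [D_gt0 sz_r uniq_r rel_x rel_r]]]]]] :=
  minCpoly_certificate (elt x).
pose r' := [seq idx w | w <- r].
have nth_r' i : (i < d)%N -> entry (encode r') i = idx (nth 0 r i).
  by move=> lt; rewrite entry_encode (nth_map 0) ?sz_r.
have entry_b c i : (i < d)%N -> entry (encode (mkseq c d)) i = c i.
  by move=> lt; rewrite entry_encode nth_mkseq.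
have rel_b y : monic_rel b b' d y <->
    monic_rel (entry (encode (mkseq b d))) (entry (encode (mkseq b' d))) d y.
  rewrite /monic_rel -(eq_nat_poly_eval y (entry_b b)).
  by rewrite -(eq_nat_poly_eval y (entry_b b')).
exists (encode [:: D; d; encode (mkseq b d); encode (mkseq b' d); encode r']).
rewrite /cert_check !entry_encode; apply/and4P; split=> //.
- by apply/monic_checkP; rewrite elt_fmul_fnat; apply/rel_b.
- apply/allP => i; rewrite mem_iota => /= lt; apply/monic_checkP.
  rewrite elt_fmul_fnat nth_r' // idxK; apply/rel_b/rel_r.
  by rewrite mem_nth ?sz_r.
apply/allP => i; rewrite mem_iota => /= lt_id.
apply/allP => j; rewrite mem_iota => /= lt_ji.
have lt_jd := ltn_trans lt_ji lt_id.
rewrite !nth_r' // (inj_eq (can_inj (@idxK P))) nth_uniq ?sz_r //.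
by rewrite neq_ltn lt_ji orbT.
Qed.

Definition cert x := search (cert_check x).

Lemma recursive_cert n a : recursive n a -> recursive n (fun O xs => cert (a O xs)).
Proof.
move=> Ha; apply: recursive_search => [|O xs]; last exact: cert_check_exists.
by rewrite /cert_check; repeat first [simple apply decidable_monic_check | recf_step].
Qed.

(** A polynomial of degree d has no further root besides the d distinct ones listed in the
    certificate. *)
Lemma cert_roots x y :
  monic_rel (entry (entry (cert x) 2)) (entry (entry (cert x) 3)) (entry (cert x) 1)
    ((entry (cert x) 0)%:R * elt y) ->
  exists2 i, (i < entry (cert x) 1)%N & y = entry (entry (cert x) 4) i.
Proof.
have /and4P[] := searchP (cert_check_exists x); rewrite -/(cert x).
move: (entry (cert x) 0) (entry (cert x) 1) (entry (cert x) 2) (entry (cert x) 3)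
  (entry (cert x) 4) => D d b b' r D_gt0 _ rel_r neq_r rel_y.
have D_neq0 : D%:R != 0 :> algC by rewrite pnatr_eq0 -lt0n.
have uniq_r : uniq [seq D%:R * elt (entry r i) | i <- iota 0 d].
  rewrite map_inj_in_uniq ?iota_uniq // => i j.
  rewrite !mem_iota /= => lt_i lt_j /(mulfI D_neq0)/(can_inj (@eltK P)) eq_ij.
  have neq u v : (u < d)%N -> (v < u)%N -> entry r u != entry r v.
    move=> lt_u lt_v; have /allP/(_ u) := neq_r; rewrite mem_iota => /(_ lt_u).
    by move/allP/(_ v); apply; rewrite mem_iota.
  case: (ltngtP i j) => // lt_ij.
    by have := neq _ _ lt_j lt_ij; rewrite eq_ij eqxx.
  by have := neq _ _ lt_i lt_ij; rewrite eq_ij eqxx.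
have /mapP[i] : D%:R * elt y \in [seq D%:R * elt (entry r i) | i <- iota 0 d].
  apply: contraT => notin.
  have := @max_poly_roots _ (monic_poly (entry b) (entry b') d)
    (D%:R * elt y :: [seq D%:R * elt (entry r i) | i <- iota 0 d]).
  rewrite size_monic_poly /= size_map size_iota ltnn notin uniq_r.
  apply => //; first by rewrite monic_neq0 // monic_monic_poly.
  apply/andP; split; first exact/monic_relP.
  apply/allP => _ /mapP[i i_d ->]; apply/monic_relP; rewrite -elt_fmul_fnat.
  exact/monic_checkP/(allP rel_r).
rewrite mem_iota => /= lt_i /(mulfI D_neq0)/(can_inj (@eltK P)) ->.
by exists i.
Qed.

Definition coef_bound q :=
  ((2 + \sum_(i < entry q 1) (entry (entry q 2) i + entry (entry q 3) i))
     ^ entry q 1)%N.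

Lemma recursive_coef_bound n a : recursive n a ->
  recursive n (fun O xs => coef_bound (a O xs)).
Proof.
move=> Ha; apply: (eq_recursive (F := fun O xs => ((2 + iteri (entry (a O xs) 1)
   (fun i r => r + (entry (entry (a O xs) 2) i + entry (entry (a O xs) 3) i)) 0)
      ^ entry (a O xs) 1)%N)) => [O xs _|]; first by rewrite iteri_sum.
by recf.
Qed.

Definition code_bound q :=
  iteri (entry q 1) (fun _ => cantor_pair (coef_bound q)) 0%N.

Lemma recursive_code_bound n a : recursive n a ->
  recursive n (fun O xs => code_bound (a O xs)).
Proof.
move=> Ha; apply: recursive_iteri; rec.
by apply: recursive_coef_bound; rec.
Qed.

Definition conjugate_check q x y :=
  all (fun e => all (fun c => all (fun c' =>
     monic_check c c' e (fmul (fnat (entry q 0)) x) ==>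
     monic_check c c' e (fmul (fnat (entry q 0)) y))
    (iota 0 (code_bound q).+1)) (iota 0 (code_bound q).+1)) (iota 0 (entry q 1).+1).

Definition conjugate x y := conjugate_check (cert x) x y.

Lemma conjugateP x y : reflect (exists f : autQbar, f (elt x) = elt y) (conjugate x y).
Proof.
have /and4P[D_gt0 rel_x _ _] := searchP (cert_check_exists x).
rewrite -/(cert x) in D_gt0 rel_x.
apply: (iffP idP) => [|[f Df]]; last first.
  apply/allP => e _; apply/allP => c _; apply/allP => c' _.
  apply/implyP => /monic_checkP/(monic_rel_aut f) rel_f; apply/monic_checkP.
  by move: rel_f; rewrite !elt_fmul_fnat rmorphM /= rmorph_nat Df.
move: rel_x => /monic_checkP; rewrite elt_fmul_fnat => rel_x check_y.
apply: (conjugate_monic D_gt0 rel_x) => e c c' le_ed le_c le_c' rel_c.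
rewrite -/(coef_bound _) in le_c le_c'.
(* The coefficients vanish from [e] on, as do the entries of the code of their first [e] values; a
   bounded code therefore represents the whole function. *)
have code_c a : (forall i, (a i <= if i < e then coef_bound (cert x) else 0)%N) ->
    exists2 s, (s < (code_bound (cert x)).+1)%N & entry s = a.
  move=> le_a; exists (encode (mkseq a e)).
    rewrite ltnS; apply: leq_encode; first by rewrite size_mkseq.
    apply/allP => _ /mapP[i + ->]; rewrite mem_iota => /= lt_i.
    by have := le_a i; rewrite lt_i.
  apply/funext => i; rewrite entry_encode; have [lt_i|le_i] := ltnP i e.
    by rewrite nth_mkseq.
  have := le_a i; rewrite ltnNge le_i leqn0 => /eqP ->.
  by rewrite nth_default ?size_mkseq.
have [s lt_s Ds] := code_c c le_c; have [s' lt_s' Ds'] := code_c c' le_c'.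
move: rel_c; rewrite -Ds -Ds' -!elt_fmul_fnat => /monic_checkP rel_x'.
apply/monic_checkP; move: rel_x'; apply/implyP.
move/allP: check_y => /(_ e); rewrite mem_iota ltnS => /(_ le_ed).
move/allP/(_ s); rewrite mem_iota => /(_ lt_s).
by move/allP/(_ s'); rewrite mem_iota; apply.
Qed.

Lemma decidable_conjugate n a b : recursive n a -> recursive n b ->
  decidable n (fun O xs => conjugate (a O xs) (b O xs)).
Proof.
move=> Ha Hb; rewrite /conjugate /conjugate_check.
by repeat first [simple apply decidable_monic_check | recf_step
  | simple apply recursive_code_bound | simple apply recursive_cert].
Qed.

(** All conjugates of [x] are entries of the list coded in the certificate, and an entry never
    exceeds the code. *)
Definition conjugate_bound x := (entry (cert x) 4).+1.

Lemma ltn_conjugate_bound x y : conjugate x y -> (y < conjugate_bound x)%N.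
Proof.
move/conjugateP => [f Df]; have /and4P[_ rel_x _ _] := searchP (cert_check_exists x).
have [|i _ ->] := @cert_roots x y; last by rewrite ltnS leq_entry.
rewrite -Df -(rmorph_nat f) -rmorphM; apply: monic_rel_aut.
by rewrite -elt_fmul_fnat; apply/monic_checkP.
Qed.

(* The guard makes the search total: it forces v to lie in F_n. *)
Definition image_check n w v s :=
  has (fun j => conjugate (z j) v) (iota 0 n.+1) ==>
  expr_check (entry s 0) (entry s 1) (entry s 2) (entry s 3) (z n) v &&
  expr_check (entry s 0) (entry s 1) (entry s 2) (entry s 3) w (entry s 4).

Lemma tower_conjugate n j v : (j <= n)%N -> conjugate (z j) v -> tower P n (elt v).
Proof.
move=> le_jn /conjugateP[f <-]; apply: (tower_mono le_jn).
exact: tower_aut (tower_zeta z_generates j).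
Qed.

(** No condition on [w] is needed: a polynomial expression for [v] can be evaluated at any number.
    If the guard fails, every [s] is accepted. *)
Lemma image_check_exists n w v : exists s, image_check n w v s.
Proof.
rewrite /image_check; case: hasP => [[j]|_]; last by exists 0%N.
rewrite mem_iota ltnS => /= le_jn /(tower_conjugate le_jn) Fv.
have [E [d [c [c' [E_gt0 rel_v]]]]] : exists E d c c', (0 < E)%N /\
    rat_expr E c c' d (zeta n) (elt v).
  by apply: gen_subfield1_expr; rewrite -z_generates.
have E_neq0 : E%:R != 0 :> algC by rewrite pnatr_eq0 -lt0n.
pose u := (nat_poly_eval c d (elt w) - nat_poly_eval c' d (elt w)) / E%:R.
exists (encode [:: E; encode (mkseq c d); encode (mkseq c' d); d; idx u]).
rewrite !entry_encode /=.
have entry_c a i : (i < d)%N -> entry (encode (mkseq a d)) i = a i.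
  by move=> lt; rewrite entry_encode nth_mkseq.
apply/andP; split; apply/expr_checkP; split=> //; rewrite /rat_expr.
  by rewrite (eq_nat_poly_eval _ (entry_c c)) (eq_nat_poly_eval _ (entry_c c')).
rewrite (eq_nat_poly_eval _ (entry_c c)) (eq_nat_poly_eval _ (entry_c c')).
by rewrite idxK mulrC divfK // subrK.
Qed.

Definition image n w v := entry (search (image_check n w v)) 4.

Lemma imageP n w v (f : autQbar) : f (zeta n) = elt w ->
  (exists2 j, (j <= n)%N & conjugate (z j) v) -> elt (image n w v) = f (elt v).
Proof.
move=> Df [j le_jn conj_v]; have := searchP (image_check_exists n w v).
rewrite /image; set s := search _; rewrite /image_check.
have -> /= : has (fun j => conjugate (z j) v) (iota 0 n.+1).
  by apply/hasP; exists j; rewrite // mem_iota.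
move=> /andP[/expr_checkP[E_gt0 /(rat_expr_aut f) rel_v] /expr_checkP[_ rel_u]].
by rewrite Df in rel_v; apply: rat_expr_fun rel_u rel_v.
Qed.

Lemma recursive_image n a b c : recursive n a -> recursive n b -> recursive n c ->
  recursive n (fun O xs => image (a O xs) (b O xs) (c O xs)).
Proof.
move=> Ha Hb Hc; rewrite /image; simple apply recursive_entry; last by rec.
apply: recursive_search => [|O xs]; last exact: image_check_exists.
rewrite /image_check.
by repeat first [simple apply decidable_expr_check | recf_step
  | simple apply decidable_conjugate].
Qed.

Ltac recg_step := first
  [ recf_step | simple apply decidable_conjugate | simple apply recursive_image
  | simple apply recursive_cert ].

(** * Tables of values of terms and formulas *)

Definition is_entry e c env := (entry e 0 == c) && (entry e 1 == env).

Definition triple c env v := encode [:: c; env; v].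

Lemma is_entry_triple c env v c' env' :
  is_entry (triple c env v) c' env' = (c == c') && (env == env').
Proof. by rewrite /is_entry !entry_encode. Qed.

Lemma entry_triple c env v : entry (triple c env v) 2 = v.
Proof. by rewrite entry_encode. Qed.

(* An element (c, env, v) of a table asserts that the term or formula coded by c
   takes the value v at the tuple of elements of Gal(F_n/Q) coded by env; an
   automorphism is represented by the image of the generator.  The two
   predicates check that an assertion follows from others in the tables. *)
Definition term_ok n (T : seq nat) e :=
  let tag := unpair1 (entry e 0) in let arg := unpair2 (entry e 0) in
  let env := entry e 1 in let v := entry e 2 in
  [|| (tag == 0%N) && (v == entry env arg),
      (tag == 1%N) && (v == z n),
      (tag == 2) && has (fun e1 => has (fun e2 =>
         [&& is_entry e1 (unpair1 arg) env, is_entry e2 (unpair2 arg) env &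
             v == image n (entry e1 2) (entry e2 2)]) T) T |
      (tag == 3) && has (fun e1 =>
         [&& is_entry e1 arg env, conjugate (z n) v &
             image n (entry e1 2) v == z n]) T].

Definition form_ok n (T F : seq nat) e :=
  let tag := unpair1 (entry e 0) in let arg := unpair2 (entry e 0) in
  let env := entry e 1 in let v := entry e 2 in
  [|| (tag == 0%N) && has (fun e1 => has (fun e2 =>
         [&& is_entry e1 (unpair1 arg) env, is_entry e2 (unpair2 arg) env &
             v == nat_of_bool (entry e1 2 == entry e2 2)]) T) T,
      (tag == 2) && has (fun e1 => has (fun e2 =>
         [&& is_entry e1 (unpair1 arg) env, is_entry e2 (unpair2 arg) env &
             v == nat_of_bool ((entry e1 2 == 1%N) && (entry e2 2 == 1%N))]) F) F,
      (tag == 3) && has (fun e1 => has (fun e2 =>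
         [&& is_entry e1 (unpair1 arg) env, is_entry e2 (unpair2 arg) env &
             v == nat_of_bool ((entry e1 2 == 1%N) || (entry e2 2 == 1%N))]) F) F |
      ((tag == 4) || (tag == 5)) &&
      ((v == nat_of_bool (tag == 4)) &&
          has (fun x => conjugate (z n) x && has (fun e1 =>
              is_entry e1 arg (cantor_pair x env) &&
              (entry e1 2 == nat_of_bool (tag == 4))) F)
            (iota 0 (conjugate_bound (z n)))
       || (v == nat_of_bool (tag == 5)) &&
          all (fun x => conjugate (z n) x ==> has (fun e1 =>
              is_entry e1 arg (cantor_pair x env) &&
              (entry e1 2 == nat_of_bool (tag == 5))) F)
            (iota 0 (conjugate_bound (z n))))].

Lemma decidable_is_entry n a b c : recursive n a -> recursive n b -> recursive n c ->
  decidable n (fun O xs => is_entry (a O xs) (b O xs) (c O xs)).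
Proof. by move=> Ha Hb Hc; rewrite /is_entry; rec. Qed.

Lemma decidable_term_ok n a b c : recursive n a -> recursive n b -> recursive n c ->
  decidable n (fun O xs => term_ok (a O xs) (listing (b O xs)) (c O xs)).
Proof.
move=> Ha Hb Hc; rewrite /term_ok; cbv zeta.
by repeat first [simple apply decidable_is_entry | recg_step].
Qed.

Lemma decidable_form_ok n a b c d : recursive n a -> recursive n b ->
  recursive n c -> recursive n d -> decidable n (fun O xs =>
    form_ok (a O xs) (listing (b O xs)) (listing (c O xs)) (d O xs)).
Proof.
move=> Ha Hb Hc Hd; rewrite /form_ok /conjugate_bound; cbv zeta.
by repeat first [simple apply decidable_is_entry | recg_step].
Qed.

Lemma has_mono (T : eqType) (S S' : seq T) (p q : pred T) :
  {subset S <= S'} -> (forall x, p x -> q x) -> has p S -> has q S'.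
Proof.
by move=> sSS' pq /hasP[x /sSS' xS /pq qx]; apply/hasP; exists x.
Qed.

(** Checks only ask for the presence of entries, so they survive enlarging a table. Consistent
    tables can thus be concatenated. *)
Lemma term_ok_mono n T T' e : {subset T <= T'} -> term_ok n T e -> term_ok n T' e.
Proof.
move=> sT; case/or4P=> /andP[tag H].
- by apply/or4P/Or41; rewrite tag.
- by apply/or4P/Or42; rewrite tag.
- apply/or4P/Or43; rewrite tag; apply: has_mono H => // e1; exact: has_mono.
- by apply/or4P/Or44; rewrite tag; apply: has_mono H.
Qed.

Lemma form_ok_mono n T T' F F' e : {subset T <= T'} -> {subset F <= F'} ->
  form_ok n T F e -> form_ok n T' F' e.
Proof.
move=> sT sF; case/or4P=> /andP[tag].
- move=> H; apply/or4P/Or41; rewrite tag; apply: has_mono H => // e1.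
  exact: has_mono.
- move=> H; apply/or4P/Or42; rewrite tag; apply: has_mono H => // e1.
  exact: has_mono.
- move=> H; apply/or4P/Or43; rewrite tag; apply: has_mono H => // e1.
  exact: has_mono.
move=> H; apply/or4P/Or44; rewrite tag; case/orP: H => /andP[v_tag H]; apply/orP;
  [left | right]; rewrite v_tag.
  apply: has_mono H => // x /andP[-> H]; exact: has_mono H.
apply: sub_all H => x; case: (conjugate _ _) => //= H; exact: has_mono H.
Qed.

(* Otherwise simplification splits [iota 0 (conjugate_bound x)]. *)
Local Opaque conjugate_bound.

Definition codes_env N env k (xs : k.-tuple autQbar) :=
  forall i : 'I_k, entry env i = idx (tnth xs i (zeta N)).

Lemma codes_env_cons N env k (xs : k.-tuple autQbar)
    (f : autQbar) : codes_env N env xs ->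
  codes_env N (cantor_pair (idx (f (zeta N))) env) [tuple of f :: xs].
Proof.
move=> env_xs i; rewrite entry_pair (tnth_nth 1%g).
case: i => [[|i] lt_i] //=; have := env_xs (Ordinal (lt_i : (i < k)%N)).
by rewrite (tnth_nth 1%g).
Qed.

Lemma conjugate_idx N (f : autQbar) : conjugate (z N) (idx (f (zeta N))).
Proof. by apply/conjugateP; exists f; rewrite idxK. Qed.

Lemma image_idx N (f g : autQbar) :
  image N (idx (f (zeta N))) (idx (g (zeta N))) = idx (f (g (zeta N))).
Proof.
apply: (can_inj (@eltK P)); rewrite (@imageP _ _ _ f) ?idxK //.
by exists N; rewrite ?conjugate_idx.
Qed.

(** The induction is on the term: an entry is justified only by entries for immediate subterms, so
    the order within the table does not matter and circular justification cannot occur. *)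
Lemma term_table_sound N T k (t : gterm k) env xs e :
  all (term_ok N T) T -> codes_env N env xs -> e \in T ->
  is_entry e (code_term t) env -> entry e 2 = idx (tval_in xs t (zeta N)).
Proof.
move=> /allP T_ok env_xs.
elim: t e => [i||s IHs t IHt|t IH] e eT /andP[/eqP De /eqP Denv].
- have := T_ok e eT; rewrite /term_ok De Denv /= unpair1K unpair2K /= orbF.
  by move/eqP => ->; apply: env_xs.
- by have := T_ok e eT; rewrite /term_ok De unpair1K /= orbF => /eqP ->; rewrite eltK.
- have := T_ok e eT; rewrite /term_ok De Denv unpair1K !unpair2K /= orbF unpair1K.
  case/hasP => e1 e1T /hasP[e2 e2T /and3P[/(IHs _ e1T)-> /(IHt _ e2T)-> /eqP ->]].
  by rewrite image_idx.
- have := T_ok e eT; rewrite /term_ok De Denv unpair1K !unpair2K /=.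
  case/hasP => e1 e1T /and3P[/(IH _ e1T)-> /conjugateP[f Df] /eqP].
  (* The value at an inverse is guessed: it is the conjugate of the generator that the automorphism
     sends back to the generator. *)
  rewrite -[entry e 2](eltK P) -Df image_idx => /(canRL (idxK P)) Dz.
  by rewrite -[in RHS]Dz autV_fun.
Qed.

(** One clause of [form_ok] serves both quantifiers: [tag == 4] is the truth value that a single
    instance settles (true for an existential, false for a universal formula), and [tag == 5] is the
    one that requires all instances. Instances range over the conjugates of the generator. *)
Lemma form_table_sound N T F k (f : form k) env xs e :
  all (term_ok N T) T -> all (form_ok N T F) F -> codes_env N env xs -> e \in F ->
  is_entry e (code_form f) env ->
  entry e 2 = nat_of_bool `[< holds_at (zeta N) f xs >].
Proof.
move=> T_ok /allP F_ok; elim: f env xs e => {k}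
  [k s t|k f IH|k f IHf g IHg|k f IHf g IHg|k f IH|k f IH]
  env xs e env_xs eF /andP[/eqP De /eqP Denv];
  have := F_ok e eF;
  rewrite /form_ok De Denv /= unpair1K ?unpair2K ?unpair1K /= ?orbF //.
- case/hasP => e1 e1T /hasP[e2 e2T /and3P[De1 De2 /eqP ->]].
  rewrite (term_table_sound T_ok env_xs e1T De1) (term_table_sound T_ok env_xs e2T De2).
  rewrite (inj_eq (can_inj (@idxK P))).
  by case: asboolP => [->|/eqP/negPf ->]; rewrite ?eqxx.
- case/hasP => e1 e1T /hasP[e2 e2T].
  case/and3P => /(IHf _ _ _ env_xs e1T)-> /(IHg _ _ _ env_xs e2T)-> /eqP ->.
  by rewrite asbool_and; do 2![case: asbool].
- case/hasP => e1 e1T /hasP[e2 e2T].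
  case/and3P => /(IHf _ _ _ env_xs e1T)-> /(IHg _ _ _ env_xs e2T)-> /eqP ->.
  by rewrite asbool_or; do 2![case: asbool].
- case/orP=> /andP[/eqP -> H].
    case/hasP: H => x _ /andP[/conjugateP[g Dg] /hasP[e1 e1F /andP[De1 /eqP v1]]].
    case: asboolP => // -[]; exists g; rewrite -[x](eltK P) -Dg in De1.
    have := IH _ _ _ (codes_env_cons g env_xs) e1F De1; rewrite v1.
    by case: asboolP.
  case: asboolP => // -[g Hg]; move/allP/(_ (idx (g (zeta N)))): H.
  rewrite mem_iota ltn_conjugate_bound ?conjugate_idx //= => /(_ isT).
  case/hasP=> e1 e1F /andP[De1 /eqP v1].
  have := IH _ _ _ (codes_env_cons g env_xs) e1F De1; rewrite v1.
  by case: asboolP.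
- case/orP=> /andP[/eqP -> H].
    case/hasP: H => x _ /andP[/conjugateP[g Dg] /hasP[e1 e1F /andP[De1 /eqP v1]]].
    case: asboolP => // /(_ g); rewrite -[x](eltK P) -Dg in De1.
    have := IH _ _ _ (codes_env_cons g env_xs) e1F De1; rewrite v1.
    by case: asboolP.
  case: asboolP => // -[g]; move/allP/(_ (idx (g (zeta N)))): H.
  rewrite mem_iota ltn_conjugate_bound ?conjugate_idx //= => /(_ isT).
  case/hasP=> e1 e1F /andP[De1 /eqP v1].
  have := IH _ _ _ (codes_env_cons g env_xs) e1F De1; rewrite v1.
  by case: asboolP.
Qed.

Lemma all_term_ok_cat N T T' : all (term_ok N T) T -> all (term_ok N T') T' ->
  all (term_ok N (T ++ T')) (T ++ T').
Proof.
move=> H H'; rewrite all_cat; apply/andP; split.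
  by apply: sub_all H => e; apply: term_ok_mono => x; rewrite mem_cat => ->.
by apply: sub_all H' => e; apply: term_ok_mono => x; rewrite mem_cat orbC => ->.
Qed.

Lemma all_form_ok_cat N T T' F F' : all (form_ok N T F) F -> all (form_ok N T' F') F' ->
  all (form_ok N (T ++ T') (F ++ F')) (F ++ F').
Proof.
move=> H H'; rewrite all_cat; apply/andP; split.
  by apply: sub_all H => e; apply: form_ok_mono => x; rewrite mem_cat => ->.
by apply: sub_all H' => e; apply: form_ok_mono => x; rewrite mem_cat orbC => ->.
Qed.

Lemma all_term_ok_cons N T e : all (term_ok N T) T -> term_ok N T e ->
  all (term_ok N (e :: T)) (e :: T).
Proof.
have sub : {subset T <= e :: T} by move=> x; rewrite inE orbC => ->.
move=> H He; rewrite /= (term_ok_mono sub He).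
by apply: sub_all H => x; apply: term_ok_mono.
Qed.

Lemma all_form_ok_cons N T F e : all (form_ok N T F) F -> form_ok N T F e ->
  all (form_ok N T (e :: F)) (e :: F).
Proof.
have sub : {subset F <= e :: F} by move=> x; rewrite inE orbC => ->.
move=> H He; rewrite /= (form_ok_mono _ sub He) //.
by apply: sub_all H => x; apply: form_ok_mono.
Qed.

Lemma has_in (T : eqType) (s : seq T) (p : pred T) x : x \in s -> p x -> has p s.
Proof. by move=> xs px; apply/hasP; exists x. Qed.

Lemma mem_catl (T : eqType) (s s' : seq T) x : x \in s -> x \in s ++ s'.
Proof. by rewrite mem_cat => ->. Qed.

Lemma mem_catr (T : eqType) (s s' : seq T) x : x \in s' -> x \in s ++ s'.
Proof. by rewrite mem_cat orbC => ->. Qed.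

Lemma term_table_complete N k (t : gterm k) env xs : codes_env N env xs ->
  exists2 T, all (term_ok N T) T &
    triple (code_term t) env (idx (tval_in xs t (zeta N))) \in T.
Proof.
move=> env_xs; elim: t => [i||s [T T_ok sT] t [T' T'_ok tT]|t [T T_ok tT]].
- exists [:: triple (code_term (TVar i)) env (idx (tnth xs i (zeta N)))];
    last exact: mem_head.
  apply: all_term_ok_cons => //; rewrite /term_ok !entry_encode /= unpair1K unpair2K.
  by rewrite env_xs !eqxx.
- exists [:: triple (code_term (TOne k)) env (z N)]; last by rewrite /= eltK mem_head.
  by apply: all_term_ok_cons => //; rewrite /term_ok !entry_encode /= unpair1K !eqxx.
- exists (triple (code_term (TMul s t)) env (idx (tval_in xs (TMul s t) (zeta N)))
            :: T ++ T'); last exact: mem_head.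
  apply: all_term_ok_cons; first exact: all_term_ok_cat.
  rewrite /term_ok !entry_encode /= unpair1K unpair2K unpair1K unpair2K /= orbF.
  apply: (has_in (mem_catl _ sT)).
  apply: (has_in (mem_catr _ tT)).
  by cbv beta; rewrite !is_entry_triple !entry_triple image_idx !eqxx.
- exists (triple (code_term (TInv t)) env (idx (tval_in xs (TInv t) (zeta N))) :: T);
    last exact: mem_head.
  apply: all_term_ok_cons => //.
  rewrite /term_ok !entry_encode /= unpair1K unpair2K /=.
  apply: (has_in tT).
  cbv beta; rewrite is_entry_triple entry_triple !eqxx conjugate_idx image_idx.
  by rewrite autVK eltK eqxx.
Qed.

Lemma form_tables_union N B (p : pred nat) (e : nat -> nat) :
  (forall x, p x -> exists T F,
     [/\ all (term_ok N T) T, all (form_ok N T F) F & e x \in F]) ->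
  exists T F, [/\ all (term_ok N T) T, all (form_ok N T F) F &
    forall x, p x -> (x < B)%N -> e x \in F].
Proof.
move=> H; elim: B => [|B [T [F [T_ok F_ok eF]]]]; first by exists [::], [::].
have [/H [T' [F' [T'_ok F'_ok eF']]]|npB] := boolP (p B).
  exists (T ++ T'), (F ++ F'); split.
  - exact: all_term_ok_cat.
  - exact: all_form_ok_cat.
  move=> x px; rewrite ltnS leq_eqVlt mem_cat => /predU1P[->|lt_x].
    by rewrite eF' orbT.
  by rewrite eF.
exists T, F; split=> // x px; rewrite ltnS leq_eqVlt => /predU1P[xB|]; last exact: eF.
by rewrite -xB px in npB.
Qed.

(** There are infinitely many [g], but truth at level N depends only on the image of the generator
    under [g]. Finitely many tables, one for each conjugate, therefore suffice. *)
Lemma form_tables_quantifier N k (f : form k.+1) env (xs : k.-tuple autQbar) :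
  (forall g : autQbar, exists T F, [/\ all (term_ok N T) T, all (form_ok N T F) F &
     triple (code_form f) (cantor_pair (idx (g (zeta N))) env)
       `[< holds_at (zeta N) f [tuple of g :: xs] >] \in F]) ->
  exists T F, [/\ all (term_ok N T) T, all (form_ok N T F) F &
    forall g : autQbar, triple (code_form f) (cantor_pair (idx (g (zeta N))) env)
       `[< holds_at (zeta N) f [tuple of g :: xs] >] \in F].
Proof.
move=> H; pose value x := `[< exists g : autQbar, g (zeta N) = elt x /\
  holds_at (zeta N) f [tuple of g :: xs] >].
have valueE (g : autQbar) :
    value (idx (g (zeta N))) = `[< holds_at (zeta N) f [tuple of g :: xs] >].
  apply/asboolP/asboolP => [[h [Dh]]|Hg]; last by exists g; rewrite idxK.
  apply: (holds_at_agree z_generates) => i; rewrite !(tnth_nth 1%g).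
  by case: i => [[|i] lt_i] //=; rewrite Dh idxK.
have [x /conjugateP[g Dg]|T [F [T_ok F_ok eF]]] :=
  @form_tables_union N (conjugate_bound (z N)) (conjugate (z N))
    (fun x => triple (code_form f) (cantor_pair x env) (value x)).
  by have := H g; rewrite -valueE Dg eltK.
exists T, F; split=> // g; rewrite -valueE; apply: eF; first exact: conjugate_idx.
by rewrite ltn_conjugate_bound ?conjugate_idx.
Qed.

Lemma form_table_complete N k (f : form k) env xs : negation_free f ->
  codes_env N env xs ->
  exists T F, [/\ all (term_ok N T) T, all (form_ok N T F) F &
    triple (code_form f) env `[< holds_at (zeta N) f xs >] \in F].
Proof.
elim: f env xs => {k} /=
  [k s t|k f IH|k f IHf g IHg|k f IHf g IHg|k f IH|k f IH] env xs //.
- move=> _ env_xs; have [T T_ok sT] := term_table_complete s env_xs.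
  have [T' T'_ok tT] := term_table_complete t env_xs.
  exists (T ++ T'); eexists [:: _]; split; [exact: all_term_ok_cat| |exact: mem_head].
  apply: all_form_ok_cons => //; rewrite /form_ok !entry_encode /= unpair1K unpair2K.
  rewrite unpair1K unpair2K /= orbF; apply: (has_in (mem_catl _ sT)).
  apply: (has_in (mem_catr _ tT)).
  cbv beta; rewrite !is_entry_triple !entry_triple !eqxx /=.
  apply/eqP; congr (nat_of_bool _).
  by rewrite (inj_eq (can_inj (@idxK P))); apply/asboolP/eqP.
- move=> /andP[nf ng] env_xs; have [T [F [T_ok F_ok fF]]] := IHf _ _ nf env_xs.
  have [T' [F' [T'_ok F'_ok gF]]] := IHg _ _ ng env_xs.
  exists (T ++ T'); eexists (_ :: F ++ F'); split;
    [exact: all_term_ok_cat| |exact: mem_head].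
  apply: all_form_ok_cons; first exact: all_form_ok_cat.
  rewrite /form_ok !entry_encode /= unpair1K unpair2K unpair1K unpair2K /= orbF.
  apply: (has_in (mem_catl _ fF)).
  apply: (has_in (mem_catr _ gF)).
  cbv beta; rewrite !is_entry_triple !entry_triple !eqxx /= asbool_and.
  by do 2![case: asbool].
- move=> /andP[nf ng] env_xs; have [T [F [T_ok F_ok fF]]] := IHf _ _ nf env_xs.
  have [T' [F' [T'_ok F'_ok gF]]] := IHg _ _ ng env_xs.
  exists (T ++ T'); eexists (_ :: F ++ F'); split;
    [exact: all_term_ok_cat| |exact: mem_head].
  apply: all_form_ok_cons; first exact: all_form_ok_cat.
  rewrite /form_ok !entry_encode /= unpair1K unpair2K unpair1K unpair2K /= orbF.
  apply: (has_in (mem_catl _ fF)).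
  apply: (has_in (mem_catr _ gF)).
  cbv beta; rewrite !is_entry_triple !entry_triple !eqxx /= asbool_or.
  by do 2![case: asbool].
- move=> nf env_xs.
  have [|T [F [T_ok F_ok fF]]] := @form_tables_quantifier N k f env xs.
    by move=> g; apply: IH nf _; apply: codes_env_cons.
  exists T; eexists (_ :: F); split; [exact: T_ok | | exact: mem_head].
  apply: all_form_ok_cons => //; rewrite /form_ok !entry_encode /= unpair1K unpair2K /=.
  apply/orP; case: asboolP => [[g Hg]|not_f]; [left | right]; rewrite eqxx /=.
    apply/hasP; exists (idx (g (zeta N))).
      by rewrite mem_iota ltn_conjugate_bound ?conjugate_idx.
    rewrite conjugate_idx; apply: (has_in (fF g)).
    by cbv beta; rewrite is_entry_triple entry_triple !eqxx; case: asboolP.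
  apply/allP => x _; apply/implyP => /conjugateP[g Dg].
  apply: (has_in (fF g)).
  cbv beta; rewrite is_entry_triple entry_triple Dg eltK !eqxx /=.
  by case: asboolP => // Hg; case: not_f; exists g.
- move=> nf env_xs.
  have [|T [F [T_ok F_ok fF]]] := @form_tables_quantifier N k f env xs.
    by move=> g; apply: IH nf _; apply: codes_env_cons.
  exists T; eexists (_ :: F); split; [exact: T_ok | | exact: mem_head].
  apply: all_form_ok_cons => //; rewrite /form_ok !entry_encode /= unpair1K unpair2K /=.
  apply/orP; case: asboolP => [all_f|/existsNP[g Hg]]; [right | left]; rewrite eqxx /=.
    apply/allP => x _; apply/implyP => /conjugateP[g Dg].
    apply: (has_in (fF g)).
    cbv beta; rewrite is_entry_triple entry_triple Dg eltK !eqxx /=.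
    by case: asboolP (all_f g).
  apply/hasP; exists (idx (g (zeta N))).
    by rewrite mem_iota ltn_conjugate_bound ?conjugate_idx.
  rewrite conjugate_idx; apply: (has_in (fF g)).
  by cbv beta; rewrite is_entry_triple entry_triple !eqxx; case: asboolP.
Qed.

(** * Stages of the program and the solution set *)

Definition left_value (O : nat -> nat) l i q := O (2 * (l * q + i))%N.
Definition right_value (O : nat -> nat) m i q := O (2 * (m * q + i)).+1%N.

(** The current value of each component must be a conjugate of the generator and reproduce all
    earlier values. The last clause deals with [m = 0]: the only join is then the zero real, so the
    real itself, read as a join of one component, must vanish at [k]. *)
Definition coherent O k m :=
  all (fun i => conjugate (z k.+1) (right_value O m i k) &&
         all (fun j => image k.+1 (right_value O m i k) (z j.+1) == right_value O m i j)
           (iota 0 k)) (iota 0 m) &&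
  ((m == 0%N) ==> (right_value O 1 0 k == 0%N)).

(** Here [e] lists the answer, an environment, a table for terms and one for formulas. The answer 0
    on incoherent data requires no tables. *)
Definition stage_check O k m l c e :=
  (~~ coherent O k m ==> (entry e 0 == 0%N)) &&
  (coherent O k m ==>
    [&& all (term_ok k.+1 (listing (entry e 2))) (listing (entry e 2)),
        all (form_ok k.+1 (listing (entry e 2)) (listing (entry e 3)))
          (listing (entry e 3)),
        all (fun i => entry (entry e 1) i == right_value O m i k) (iota 0 m),
        all (fun i => entry (entry e 1) (m + i)%N == left_value O l i k) (iota 0 l) &
        has (fun e1 => e1 == triple c (entry e 1) (entry e 0)) (listing (entry e 3))]).

Lemma recursive_triple n a b c : recursive n a -> recursive n b -> recursive n c ->
  recursive n (fun O xs => triple (a O xs) (b O xs) (c O xs)).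
Proof. by move=> Ha Hb Hc; rewrite /triple /encode /=; rec. Qed.

Lemma stage_program : exists p : prog 4, forall O k m l c,
  (exists e, stage_check O k m l c e) ->
  eval O p [tuple k; m; l; c] (entry (search (stage_check O k m l c)) 0).
Proof.
pose f O ys := stage_check O (head 0%N ys) (head 0%N (behead ys))
  (head 0%N (behead (behead ys))) (head 0%N (behead (behead (behead ys)))).
have [|p Hp] := @eval_search 4 f.
  rewrite /f /stage_check /coherent /left_value /right_value.
  by repeat first [simple apply decidable_term_ok | simple apply decidable_form_ok
    | recg_step | simple apply recursive_triple].
have [p0 Hp0] : recursive 1 (fun _ ys => entry (head 0%N ys) 0) by rec.
exists (Comp p0 (fun=> p)) => O k m l c ex_e /=.
exists [tuple search (stage_check O k m l c)] => [i|]; last exact: Hp0.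
by rewrite (tnth_nth 0%N) (ord1 i); apply: Hp.
Qed.

Lemma coherentP O k m : coherent O k m ->
  exists s : m.-tuple autQbar, forall i : 'I_m,
    tnth s i (zeta k.+1) = elt (right_value O m i k) /\
    forall j, (j < k)%N -> tnth s i (zeta j.+1) = elt (right_value O m i j).
Proof.
move=> /andP[/allP coh _].
have [i|s Hs] := @choice 'I_m autQbar (fun i f =>
  f (zeta k.+1) = elt (right_value O m i k) /\
  forall j, (j < k)%N -> f (zeta j.+1) = elt (right_value O m i j)).
  have := coh i; rewrite mem_iota => /(_ (ltn_ord i)).
  move=> /andP[/conjugateP[f Df] /allP coh_i].
  exists f; split=> // j lt_jk; have := coh_i j; rewrite mem_iota => /(_ lt_jk).
  move=> /eqP <-; rewrite (imageP Df) //; exists j.+1; first by rewrite ltnS ltnW.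
  by apply/conjugateP; exists 1%g.
by exists [tuple s i | i < m] => i; rewrite tnth_mktuple.
Qed.

Lemma codes_env_cat N m l (s : m.-tuple autQbar) (a : l.-tuple autQbar) env :
  (forall i : 'I_m, entry env i = idx (tnth s i (zeta N))) ->
  (forall i : 'I_l, entry env (m + i)%N = idx (tnth a i (zeta N))) ->
  codes_env N env [tuple of s ++ a].
Proof.
move=> env_s env_a i; rewrite (tnth_nth 1%g) /= nth_cat size_tuple.
have [lt_im|le_mi] := ltnP i m.
  by rewrite (env_s (Ordinal lt_im)) (tnth_nth 1%g).
have lt_il : (i - m < l)%N by rewrite ltn_subLR // ltn_ord.
by have := env_a (Ordinal lt_il); rewrite /= subnKC // (tnth_nth 1%g).
Qed.

Section Stage.
Variables (O : nat -> nat) (k m l : nat) (psi : form (m + l)).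
Variables (s : m.-tuple autQbar) (a : l.-tuple autQbar).
Hypothesis psi_nf : negation_free psi.
Hypothesis s_code : forall i : 'I_m, tnth s i (zeta k.+1) = elt (right_value O m i k).
Hypothesis a_code : forall i : 'I_l, left_value O l i k = idx (tnth a i (zeta k.+1)).

Lemma stage_check_sound e : coherent O k m -> stage_check O k m l (code_form psi) e ->
  entry e 0 = nat_of_bool `[< holds_at (zeta k.+1) psi [tuple of s ++ a] >].
Proof.
move=> coh; rewrite /stage_check coh implyTb => /andP[_].
move=> /and5P[T_ok F_ok /allP env_s /allP env_a].
case/hasP => e1 e1F /eqP De1.
have env_sa : codes_env k.+1 (entry e 1) [tuple of s ++ a].
  apply: codes_env_cat => i.
    by rewrite s_code eltK; apply/eqP/env_s; rewrite mem_iota ltn_ord.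
  by rewrite -a_code; apply/eqP/env_a; rewrite mem_iota ltn_ord.
have := form_table_sound (f := psi) T_ok F_ok env_sa e1F.
by rewrite De1 is_entry_triple !eqxx entry_triple; apply.
Qed.

Lemma stage_check_complete : coherent O k m ->
  exists e, stage_check O k m l (code_form psi) e.
Proof.
move=> coh; pose env := encode ([seq right_value O m i k | i <- iota 0 m] ++
                                [seq left_value O l i k | i <- iota 0 l]).
have env_s i : (i < m)%N -> entry env i = right_value O m i k.
  move=> lt; rewrite entry_encode nth_cat size_map size_iota lt.
  by rewrite (nth_map 0%N) ?size_iota // nth_iota.
have env_a i : (i < l)%N -> entry env (m + i)%N = left_value O l i k.
  move=> lt; rewrite entry_encode nth_cat size_map size_iota ltnNge leq_addr /=.
  by rewrite addKn (nth_map 0%N) ?size_iota // nth_iota.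
have env_sa : codes_env k.+1 env [tuple of s ++ a].
  apply: codes_env_cat => i; first by rewrite env_s // s_code eltK.
  by rewrite env_a // a_code.
have [T [F [T_ok F_ok inF]]] := form_table_complete psi_nf env_sa.
pose tab S := cantor_pair (size S) (encode S).
exists (encode [:: nat_of_bool `[< holds_at (zeta k.+1) psi [tuple of s ++ a] >];
                   env; tab T; tab F]).
rewrite /stage_check coh !entry_encode /= !listing_encode T_ok F_ok /=.
apply/and3P; split.
- by apply/allP => i; rewrite mem_iota => /= /env_s ->.
- by apply/allP => i; rewrite mem_iota => /= /env_a ->.
- by rewrite has_pred1.
Qed.

End Stage.

Section Solution.
Variables (m l : nat) (psi : form (m + l)) (a : l.-tuple autQbar) (X : nat -> nat).
Hypothesis psi_nf : negation_free psi.

Let O := join (aut_join P z a) X.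

Lemma left_value_join k (i : 'I_l) : left_value O l i k = idx (tnth a i (zeta k.+1)).
Proof.
have l_gt0 : (0 < l)%N by case: l i => [[]|].
rewrite /left_value /O /join mul2n odd_double doubleK /aut_join /joins.
rewrite mulnC divnMDl // modnMDl modn_small // divn_small // addn0.
by rewrite (nth_map 1%g) ?size_tuple // (tnth_nth 1%g).
Qed.

Lemma right_value_join n i q : right_value O n i q = X (n * q + i)%N.
Proof. by rewrite /right_value /O /join mul2n /= odd_double uphalf_double. Qed.

Lemma stage_check_exists k : exists e, stage_check O k m l (code_form psi) e.
Proof.
have [coh|ncoh] := boolP (coherent O k m); last first.
  by exists (encode [:: 0%N]); rewrite /stage_check (negPf ncoh) entry_encode.
have [s Hs] := coherentP coh.
by apply: (stage_check_complete psi_nf (s := s) (a := a)) coh => i;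
  [case: (Hs i) | apply: left_value_join].
Qed.

(** The choice of [s] is immaterial: tuples with the prescribed values at the generator agree on all
    of F_(k+1). *)
Lemma stage_value k e : stage_check O k m l (code_form psi) e ->
  entry e 0 = nat_of_bool `[< coherent O k m /\ exists2 s : m.-tuple autQbar,
    forall i : 'I_m, tnth s i (zeta k.+1) = elt (right_value O m i k) &
    holds_at (zeta k.+1) psi [tuple of s ++ a] >].
Proof.
move=> e_ok; have [coh|ncoh] := boolP (coherent O k m); last first.
  move: e_ok; rewrite /stage_check ncoh => /andP[/eqP -> _].
  by case: asboolP => // -[].
have [s Hs] := coherentP coh.
have s_code i : tnth s i (zeta k.+1) = elt (right_value O m i k) by case: (Hs i).
rewrite (stage_check_sound s_code (left_value_join k) coh e_ok).
congr nat_of_bool; apply/asboolP/asboolP => [psi_s|[_ [s' Hs' psi_s']]].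
  by split=> //; exists s.
apply: (holds_at_agree z_generates) psi_s' => i; rewrite !(tnth_nth 1%g) /= !nth_cat.
rewrite !size_tuple; case: ltnP => // lt_im.
by have := Hs' (Ordinal lt_im); rewrite -s_code !(tnth_nth 1%g) => ->.
Qed.

Lemma aut_join_coherent (g : m.-tuple autQbar) k : X = aut_join P z g ->
  coherent O k m /\ forall i : 'I_m, tnth g i (zeta k.+1) = elt (right_value O m i k).
Proof.
move=> DX; have Xg (i : 'I_m) q : right_value O m i q = idx (tnth g i (zeta q.+1)).
  have m_gt0 : (0 < m)%N by case: m i => [[]|].
  rewrite right_value_join DX /aut_join /joins.
  rewrite mulnC divnMDl // modnMDl modn_small // divn_small // addn0.
  by rewrite (nth_map 1%g) ?size_tuple // (tnth_nth 1%g).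
split=> [|i]; last by rewrite Xg idxK.
apply/andP; split; last first.
  apply/implyP => /eqP m0; rewrite right_value_join DX /aut_join /joins nth_default //.
  by rewrite size_tuple m0.
apply/allP => i; rewrite mem_iota => /= lt_im.
rewrite !(Xg (Ordinal lt_im)) conjugate_idx.
apply/allP => j; rewrite mem_iota => /= lt_jk; rewrite (Xg (Ordinal lt_im)).
apply/eqP/(can_inj (@eltK P)); rewrite idxK; apply: imageP; first by rewrite idxK.
exists j.+1; first by rewrite ltnS ltnW.
by apply/conjugateP; exists 1%g.
Qed.

Lemma coherent_aut_join : (forall k, coherent O k m) -> exists g : m.-tuple autQbar,
  X = aut_join P z g.
Proof.
move=> coh; have [s Hs] := choice (fun k => coherentP (coh k)).
have glue (i : 'I_m) : exists f : autQbar, forall k,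
    f (zeta k.+1) = elt (right_value O m i k).
  have Qz0 : zeta 0 \in Crat by have := tower_zeta z_generates 0.
  (* Stage k provides level k+1, hence the shift; at level 0 the generator is rational and all
     automorphisms agree. *)
  have [[|j] [|n] // le_jn|f Hf] :=
    tower_glue z_generates (s := fun n => tnth (s n.-1) i).
  - by rewrite !aut_Crat.
  - have [Dn Dj] := Hs n i; have [-> _] := Hs j i.
    move: le_jn; rewrite ltnS leq_eqVlt => /predU1P[->//|]; exact: Dj.
  exists f => k; rewrite (Hf k.+1 _ (tower_zeta z_generates _)).
  by case: (Hs k i).
have [g Hg] := choice glue; exists [tuple g i | i < m]; apply/funext => j.
rewrite /aut_join /joins; have [m0|m_gt0] := posnP m.
  rewrite nth_default ?size_tuple ?m0 //.
  by have /andP[_] := coh j; rewrite m0 right_value_join mul1n addn0 => /eqP ->.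
have lt_j : (j %% m < m)%N by rewrite ltn_mod.
rewrite (nth_map 1%g) ?size_tuple // -(tnth_nth _ _ (Ordinal lt_j)) tnth_mktuple.
by rewrite /aut_real Hg eltK right_value_join mulnC -divn_eq.
Qed.

End Solution.

Lemma uniform_program : exists p : prog 4,
  forall m l (psi : form (m + l)) (a : l.-tuple autQbar), negation_free psi ->
  Pi01_by p [tuple m; l; code_form psi] (aut_join P z a) (solution_set P z psi a).
Proof.
have [p Hp] := stage_program; exists p => m l psi a psi_nf.
have tupleE k : [tuple of k :: [tuple m; l; code_form psi]] =
    [tuple k; m; l; code_form psi] by apply/val_inj.
pose v X k := entry (search
  (stage_check (join (aut_join P z a) X) k m l (code_form psi))) 0.
have eval_v X k : eval (join (aut_join P z a) X) p
    [tuple of k :: [tuple m; l; code_form psi]] (v X k).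
  by rewrite tupleE; apply/Hp/stage_check_exists.
have vE X k := stage_value (searchP (stage_check_exists a X psi_nf k)).
split=> [X k|].
  by have := eval_v X k; rewrite /v vE => eval_b; eexists; apply: eval_b.
apply/seteqP; split=> [_ [g psi_g <-] k|X /= eval1].
  rewrite /= -[X in eval _ _ _ X]/(nat_of_bool true); have := eval_v (aut_join P z g) k.
  rewrite /v vE; case: asboolP => // -[].
  have [coh Dg] := aut_join_coherent a k (erefl (aut_join P z g)).
  split=> //; exists g => //.
  by have /(holdsP z_generates _ psi_nf) := psi_g; apply.
have stage k : coherent (join (aut_join P z a) X) k m /\
    exists2 s : m.-tuple autQbar, forall i : 'I_m, tnth s i (zeta k.+1) =
        elt (right_value (join (aut_join P z a) X) m i k) &
      holds_at (zeta k.+1) psi [tuple of s ++ a].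
  have := eval_fun (eval_v X k) (eval1 k); by rewrite /v vE; case: asboolP.
have [g DX] := coherent_aut_join (fun k => (stage k).1).
exists g => //; apply/(holdsP z_generates _ psi_nf) => N.
(* Stage [N] speaks about level [N.+1]; passing down to [N] also covers level 0, which has no stage
   of its own. *)
apply: (holds_at_mono z_generates (leqnSn N) psi_nf).
have [_ [s Ds psi_s]] := stage N; have [_ Dg] := aut_join_coherent a N DX.
apply: (holds_at_agree z_generates) psi_s => i; rewrite !(tnth_nth 1%g) /= !nth_cat.
rewrite !size_tuple; case: ltnP => // lt_im.
by have := Ds (Ordinal lt_im); rewrite -Dg !(tnth_nth 1%g) => ->.
Qed.

End Programs.

(** The parameters are hardwired as constant programs, as in the s-m-n theorem. *)
Lemma Pi01_by_rel n (p : prog n.+1) c A S : Pi01_by p c A S -> Pi01_rel A S.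
Proof.
move=> [halt DS]; pose cst j : prog 1 := iter j (fun r => Comp Succ (fun=> r)) (Zero 1).
pose q : prog 1 := Comp p (fun i =>
  if unlift ord0 i is Some j then cst (tnth c j) else Proj ord0).
have const_eval O k j : eval O (cst j) [tuple k] j.
  by elim: j => //= j IH; exists [tuple j] => // i; rewrite (tnth_nth 0%N) (ord1 i).
have q_eval O k v : eval O p [tuple of k :: c] v -> eval O q [tuple of k :: [tuple]] v.
  move=> pv; exists [tuple of k :: c] => // i.
  case: unliftP => [j|] ->; last by [].
  rewrite tnthS; have -> : [tuple of k :: [tuple]] = [tuple k] by apply/val_inj.
  exact: const_eval.
exists q; split=> [X k|]; first by have [b /q_eval] := halt X k; exists b.
rewrite DS; apply/seteqP; split=> X /= HX k; first exact/q_eval.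
(* Since [p] halts, its value is also a value of [q], and evaluation is deterministic. *)
have [b Hb] := halt X k; have := eval_fun (q_eval _ _ _ Hb) (HX k).
by case: b Hb.
Qed.

Theorem theorem5p1 (P : presentation) (z : nat -> nat)
  (z_computable : computable1 z) (z_generates : primitive_generators P z) :
  (forall (m l : nat) (psi : form (m + l)) (a : l.-tuple autQbar),
     positive psi ->
     Pi01_rel (aut_join P z a) (solution_set P z psi a)) /\
  (exists p : prog 4,
     forall (m l : nat) (psi : form (m + l)) (a : l.-tuple autQbar),
       positive psi ->
       Pi01_by p [tuple m; l; code_form psi] (aut_join P z a)
         (solution_set P z psi a)).
Proof.
have [p Hp] := uniform_program z_computable z_generates.
split=> [m l psi a /andP[_ psi_nf]|]; first exact: Pi01_by_rel (Hp m l psi a psi_nf).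
by exists p => m l psi a /andP[_ psi_nf]; apply: Hp.
Qed.
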